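(* Let $m\ge 2$, $q=3^m$, $\mathbb{F}=\mathbb{F}_q$, and $a\in\mathbb{F}^*$. Let $u_1\in\mathbb{F}$ be such that $u_1^3+u_1^2-a$ is a square in $\mathbb{F}$ (i.e. there is $y\in\mathbb{F}$ with $(u_1,y)\in E(a)$) and $$\mathrm{Tr}\!\left(\frac{a\sqrt{u_1^3+u_1^2-a}}{u_1^3}\right)\neq 0$$ (this condition does not depend on the choice of square root). Define $u_2,u_3,\dots$ recursively by $$u_{i+1}=\frac{(u_i^3-a)^3+a\,u_i^3}{(u_i^3-a)^2},\qquad i=1,2,\dots,$$ the recursion being continued as long as $u_i\neq a^{1/3}$. Then there exists an integer $k\le m$ such that one of the following holds: (i) $u_k=a^{1/3}$ and $u_i\neq a^{1/3}$ for all $i<k$; or (ii) $u_{k+1}=u_{k+1+r}$ for some integer $r\ge 1$, and the elements $u_i$, $1\le i<k+1+r$, are pairwise distinct. In either case $3^k$ divides $K(a)$ and $3^{k+1}$ does not divide $K(a)$ (with the convention below when $K(a)=0$).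
   Context: $\mathbb{F}=\mathbb{F}_{3^m}$ and $\mathrm{Tr}(x)=x+x^3+\dots+x^{3^{m-1}}$ is the absolute trace to $\mathbb{F}_3$. For $x\in\mathbb{F}$ and $i\ge1$, $x^{-i}$ means $x^{q-1-i}$, and $b/x=b\,x^{-1}$. $a^{1/3}$ denotes the unique cube root of $a$ in $\mathbb{F}$. With $\omega=e^{2\pi i/3}$, $K(a)=\sum_{x\in\mathbb{F}}\omega^{\mathrm{Tr}(x+a/x)}$. $E(a)=\{(x,y)\in\mathbb{F}\times\mathbb{F}: y^2=x^3+x^2-a\}$. Convention: if $K(a)=0$, one says that $3^m$ divides $K(a)$ but $3^{m+1}$ does not. *)

(* Defs.v *)
From HB Require Import structures.
From mathcomp Require Import all_boot all_order all_algebra all_field.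
Set Implicit Arguments. Unset Strict Implicit. Unset Printing Implicit Defensive.
Import Order.TTheory GRing.Theory Num.Theory.
Local Open Scope ring_scope.

(* Absolute trace F_{3^m} -> F_3 (values lie in the prime field inside F). *)
Definition Tr (m : nat) (F : finFieldType) (x : F) : F :=
  \sum_(i < m) x ^+ (3 ^ i)%N.

(* omega = e^{2 pi i/3} = (-1 + i sqrt 3)/2 in algC. *)
Definition omega : algC := (-1 + 'i * sqrtC 3) / 2.

(* exponent in {0,1,2} representing an element t of F_3 <= F *)
Definition f3exp (F : finFieldType) (t : F) : nat :=
  if t == 0 then 0%N else if t == 1 then 1%N else 2%N.

(* Kloosterman sum K(a) = sum_x omega^{Tr(x + a/x)}, with a/0 = 0 (x^{-1} = x^{q-2}). *)
Definition Kl (m : nat) (F : finFieldType) (a : F) : algC :=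
  \sum_(x : F) omega ^+ f3exp (Tr m (x + a / x)).

Definition Ecurve (F : finFieldType) (a : F) : {set F * F} :=
  [set p : F * F | p.2 ^+ 2 == p.1 ^+ 3 + p.1 ^+ 2 - a].

(* the unique cube root of a in F (default 0 if none; it always exists in char 3) *)
Definition cbrt (F : finFieldType) (a : F) : F :=
  odflt 0 [pick c : F | c ^+ 3 == a].

(* recursion map and the sequence u_1 = u1, u_{i+1} = g(u_i) (indices i >= 1) *)
Definition ustep (F : finFieldType) (a u : F) : F :=
  ((u ^+ 3 - a) ^+ 3 + a * u ^+ 3) / (u ^+ 3 - a) ^+ 2.
Definition useq (F : finFieldType) (a u1 : F) (i : nat) : F :=
  iter i.-1 (ustep a) u1.

(* "3^j divides z" (divisibility among algebraic integers), with the paper's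
   convention: if z = 0, 3^j divides z iff j <= m. *)
Definition pow3_dvd (m j : nat) (z : algC) : bool :=
  if z == 0 then (j <= m)%N else (z / 3 ^+ j) \in Aint.

(* Main.v *)
Require Import Defs.
From HB Require Import structures.
From mathcomp Require Import all_boot all_order all_algebra all_field.
From mathcomp Require Import all_fingroup all_solvable ring zify.
Set Implicit Arguments. Unset Strict Implicit. Unset Printing Implicit Defensive.
Import Order.TTheory GRing.Theory Num.Theory.

(** Put a = c^3. The recursion u -> ustep a u is the x-coordinate of the
    tripling map T of E(a) : y^2 = x^3 + x^2 - a, and T is the Frobenius after
    the isogeny (x, y) |-> (z^2 - 1 - c/(x-c), z^3 - z), z = y/(x-c), from E(a)
    to E(c). The fibres of T are Artin-Schreier: z is determined up to F_3.

    The group law is replaced by the collinearity relation P + Q + R = 0, which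
    T preserves; associativity is never needed. The iterated images
    S_j = T^j(E(a)) are closed under collinearity, and either the 3-torsion
    point W = (c, c) lies in S_j and |S_j| = 3 |S_(j+1)|, or T is injective on
    S_j and Cauchy's counting argument shows that 3 does not divide |S_j|. If k
    is the first index of the second kind, then 3^k is the exact power of 3
    dividing |E(a)|; a point outside T(E(a)) enters S_k after exactly k steps
    and then either sits at the origin or moves on a cycle.

    Tr(a y / x^3) = Tr(y) on E(a), because a y / x^3 = y - (h^3 - h) for
    h = y/x, and it vanishes on T(E(a)), whose second coordinates are cubes of
    elements z^3 - z. Finally |E(a)| = q + K(a), by counting the curve
    w^2 = (z^3 - z)^2 - a in two ways. *)

(** * Iterated images of a map preserving collinearity *)

(** [f] generates a group of order 1 or 3 acting on [D], and a 3-group acting on a set fixes a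
    number of points congruent to its cardinality. *)
Lemma card_fix3_mod (Y : finType) (f : Y -> Y) (D : {set Y}) :
    (forall x, f (f (f x)) = x) -> (forall x, x \in D -> f x \in D) ->
  #|D| = #|[set x in D | f x == x]| %[mod 3].
Proof.
move=> f3 fD; have injf : injective f by move=> x y e; rewrite -(f3 x) e f3.
pose s := perm injf.
have s3 : (s ^+ 3 = 1)%g.
  by apply/permP=> x; rewrite !expgS expg0 mulg1 !permM !permE /= f3.
have p3 : (3.-group <[s]>)%g.
  rewrite /pgroup /= -orderE; apply: (@pnat_dvd _ 3); last by [].
  by rewrite order_dvdn s3.
have acts : [acts <[s]>%g, on D | 'P].
  rewrite cycle_subG; apply/astabsP => x; rewrite /= /aperm permE.
  by apply/idP/idP => [/fD/fD|/fD//]; rewrite f3.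
rewrite (pgroup_fix_mod p3 acts); congr (_ %% _); apply: eq_card => x.
rewrite in_setI afix_cycle [in RHS]inE; congr (_ && _).
by apply/afix1P/eqP; rewrite /= /aperm permE.
Qed.

(** * Abstract tripling map; [C p q r] stands for p + q + r = 0 *)

Section TriplingDynamics.
Variables (X : finType) (C : X -> X -> X -> bool) (S : {set X}) (O W : X).
Variables (neg T : X -> X).
Hypothesis C_sym : forall p q r, C p q r -> C q p r.
Hypothesis C_rot : forall p q r, C p q r -> C q r p.
Hypothesis C_ex : forall p q, p \in S -> q \in S -> exists2 r, r \in S & C p q r.
Hypothesis C_uniq : forall p q r r', C p q r -> C p q r' -> r = r'.
Hypothesis C_neg : forall p, C O p (neg p).
Hypothesis C_flex : forall p, p \in S -> C p p p -> [\/ p = O, p = W | p = neg W].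
Hypothesis C_O : C O O O.
Hypothesis SO : O \in S.
Hypothesis SW : W \in S.
Hypothesis TS : forall p, p \in S -> T p \in S.
Hypothesis T_O : T O = O.
Hypothesis T_C : forall p q r, C p q r -> p \in S -> q \in S -> r \in S -> C (T p) (T q) (T r).
Hypothesis T_ker : forall p, p \in S -> T p = O -> [\/ p = O, p = W | p = neg W].
Hypothesis T_eq : forall p q, p \in S -> q \in S -> T p = T q ->
  [\/ p = q, C p (neg q) W | C p (neg q) (neg W)].
Hypothesis T_fib : forall p, p \in S -> #|[set q in S | T q == T p]| = 3.

Definition lvl j := iter j (fun A : {set X} => T @: A) S.

Let negK p : neg (neg p) = p.
Proof. exact: C_uniq (C_neg (neg p)) (C_rot (C_rot (C_sym (C_rot (C_neg p))))). Qed.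

Let lvlS j : lvl j.+1 = T @: lvl j. Proof. by []. Qed.

Lemma lvl_anti j : lvl j.+1 \subset lvl j.
Proof.
elim: j => [|j IH]; first by apply/subsetP => _ /imsetP[p pS ->]; apply: TS.
by rewrite lvlS (lvlS j) imsetS.
Qed.

Lemma lvl_leq i j : i <= j -> lvl j \subset lvl i.
Proof.
move/subnK <-; elim: (j - i) => [|d IH] //.
exact: subset_trans (lvl_anti _) IH.
Qed.

Lemma lvl_sub j p : p \in lvl j -> p \in S.
Proof. exact: (subsetP (lvl_leq (leq0n j))). Qed.

Lemma lvl_O j : O \in lvl j.
Proof. by elim: j => // j IH; rewrite lvlS -T_O imset_f. Qed.

(** The third point on the line through two preimages is mapped by [T] to a third point on the line
    through the images, and that point is unique. *)
Lemma lvl_C j p q r : p \in lvl j -> q \in lvl j -> C p q r -> r \in lvl j.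
Proof.
elim: j p q r => [|j IH] p q r.
  by move=> pS qS c; have [r' r'S c'] := C_ex pS qS; rewrite (C_uniq c c').
rewrite lvlS => /imsetP[p' p'j ->] /imsetP[q' q'j ->] c.
have [r' r'S c'] := C_ex (lvl_sub p'j) (lvl_sub q'j).
rewrite (C_uniq c (T_C c' (lvl_sub p'j) (lvl_sub q'j) r'S)) imset_f //.
exact: IH c'.
Qed.

Lemma lvl_neg j p : p \in lvl j -> neg p \in lvl j.
Proof. by move=> pj; apply: lvl_C (lvl_O j) pj (C_neg p). Qed.

Let T_neg p : p \in S -> T (neg p) = neg (T p).
Proof.
move=> pS; have := T_C (C_neg p) SO pS (@lvl_neg 0 p pS).
by rewrite T_O => /C_uniq; apply; apply: C_neg.
Qed.

(** Points of one fibre of [T] differ by 0, [W] or [neg W], so if [W] is in [lvl j] a fibre meeting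
    [lvl j] stays inside it. *)
Let T_eq_lvl j p q : W \in lvl j -> p \in S -> q \in lvl j -> T p = T q ->
  p \in lvl j.
Proof.
move=> Wj pS qj e; case: (T_eq pS (lvl_sub qj) e) => [->//||] /C_rot c.
  exact: lvl_C (lvl_neg qj) Wj c.
exact: lvl_C (lvl_neg qj) (lvl_neg Wj) c.
Qed.

Lemma card_lvl_W j : W \in lvl j -> #|lvl j| = 3 * #|lvl j.+1|.
Proof.
move=> Wj; rewrite lvlS -[LHS]sum1_card (partition_big_imset T) /=.
rewrite (eq_bigr (fun=> 3)); first by rewrite sum_nat_const mulnC.
move=> _ /imsetP[p pj ->]; rewrite sum1dep_card -(T_fib (lvl_sub pj)).
apply: eq_card => q; rewrite !inE; apply/andP/andP => -[qS /eqP e].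
  by rewrite (lvl_sub qS) e.
by rewrite (T_eq_lvl Wj qS pj e) e.
Qed.

(** Two distinct points with the same image would put [W] or [neg W] on the line through p and
    [neg q], hence [W] into [lvl j]. *)
Lemma lvl_inj j : W \notin lvl j -> {in lvl j &, injective T}.
Proof.
move=> nWj p q pj qj e; have nq := lvl_neg qj.
case: (T_eq (lvl_sub pj) (lvl_sub qj) e) => // c; case/negP: nWj.
  exact: lvl_C pj nq c.
by rewrite -(negK W); apply/lvl_neg/(lvl_C pj nq c).
Qed.

(* Cauchy's argument: rotate the triples of collinear points. *)
Lemma lvl_card_nW j : W \notin lvl j -> ~~ (3 %| #|lvl j|).
Proof.
move=> nWj; set A := lvl j.
pose f (t : X * X * X) := (t.1.2, t.2, t.1.1).
pose D := [set t : X * X * X | [&& t.1.1 \in A, t.1.2 \in A & C t.1.1 t.1.2 t.2]].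
have : #|D| = #|[set x in D | f x == x]| %[mod 3].
  apply: card_fix3_mod => [[[p q] r]//|[[p q] r]].
  by rewrite !inE /= => /and3P[pA qA c]; rewrite qA (lvl_C pA qA c) C_rot.
have -> : #|[set x in D | f x == x]| = 1.
  apply/eqP/cards1P; exists (O, O, O); apply/setP => -[[p q] r].
  rewrite !inE /f /= !xpair_eqE; apply/idP/idP.
    case/andP=> /and3P[pA qA c] /andP[/andP[/eqP e /eqP e'] _]; subst q; subst r.
    by case: (C_flex (lvl_sub pA) c) => e; subst p; rewrite ?eqxx //;
      case/negP: nWj => //; rewrite -(negK W); apply: lvl_neg.
  by case/andP=> /andP[/eqP-> /eqP->] /eqP->; rewrite lvl_O C_O !eqxx.
have -> : #|D| = #|A| * #|A|.
  rewrite -cardsX -(card_in_imset (f := fst) (D := mem D)).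
    apply: eq_card => -[p q]; rewrite in_setX; apply/imsetP/andP.
      by case=> -[[p' q'] r]; rewrite inE => /and3P[/= ? ? _] [-> ->].
    case=> pA qA; have [r _ c] := C_ex (lvl_sub pA) (lvl_sub qA).
    by exists (p, q, r) => //; rewrite inE /= pA qA.
  move=> [[p q] r] [[p' q'] r']; rewrite !inE /= => /and3P[_ _ c] /and3P[_ _ c'].
  by move=> [e e']; subst p' q'; rewrite (C_uniq c c').
by move=> e; apply/negP => d; move: e; rewrite -modnMm (eqP d).
Qed.

Lemma depth_exists : exists k, [/\ W \notin lvl k, forall j, j < k -> W \in lvl j
  & #|S| = 3 ^ k * #|lvl k|].
Proof.
have key j : (forall i, i < j -> W \in lvl i) -> #|S| = 3 ^ j * #|lvl j|.
  elim: j => [|j IH] h; first by rewrite mul1n.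
  rewrite IH => [|i ij]; last by apply: h; lia.
  by rewrite (card_lvl_W (h j _)) // mulnA expnSr.
have gt0 j : 0 < #|lvl j| by apply/card_gt0P; exists O; apply: lvl_O.
have lt3 j : j < 3 ^ j by apply: ltn_expl.
(* If [W] stayed up to index n = |S|, then |S| would be a positive multiple of 3^n > n. *)
have [/forallP all_W|] := boolP [forall j : 'I_#|S|.+1, W \in lvl j].
  have := key #|S| (fun i h => all_W (Ordinal (ltnW h : i < #|S|.+1))).
  by have := gt0 #|S|; have := lt3 #|S|; nia.
rewrite negb_forall => /existsP[i0 nW].
have ex : exists k, W \notin lvl k by exists i0.
exists (ex_minn ex); case: ex_minnP => k nWk kmin.
have Wlt j : j < k -> W \in lvl j.
  by move=> jk; apply: contraLR jk => /kmin; rewrite -leqNgt.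
by split=> //; apply: key.
Qed.

(** * Orbit of a point outside the image of [T] *)

Section Orbit.
Variables (k : nat) (P : X).
Hypothesis nWk : W \notin lvl k.
Hypothesis Wk : forall j, j < k -> W \in lvl j.
Hypothesis PS : P \in S.
Hypothesis nP : P \notin T @: S.

Let iter_in_S i : iter i T P \in S.
Proof. by elim: i => // i IH; apply: TS. Qed.

Lemma iter_lvl i : iter i T P \in lvl i.
Proof. by elim: i => // i IH; apply: imset_f. Qed.

(** Below [k] the fibres meeting a level lie in it, so an iterate that is one level too deep would
    force its predecessor to be so too, down to [P] in the image of [T]. *)
Lemma iter_nlvl i : i < k -> iter i T P \notin lvl i.+1.
Proof.
elim: i => [|i IH] ik //; apply/negP; rewrite lvlS => /imsetP[q qi e].
by case/negP: (IH (ltnW ik)); exact: T_eq_lvl (Wk ik) (iter_in_S i) qi e.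
Qed.

Lemma iter_nk i : i < k -> iter i T P \notin lvl k.
Proof. by move=> ik; apply: contra (iter_nlvl ik); apply: (subsetP (lvl_leq ik)). Qed.

Lemma iter_k i : k <= i -> iter i T P \in lvl k.
Proof. by move=> ki; apply: (subsetP (lvl_leq ki)); apply: iter_lvl. Qed.

Lemma iter_nO i : i < k -> iter i T P != O.
Proof. by move/iter_nk; apply: contraNneq => ->; apply: lvl_O. Qed.

Let T_inj := lvl_inj nWk.

Lemma iter_O i : iter k T P != O -> iter i T P != O.
Proof.
move=> nO; case: (ltnP i k) => [/iter_nO//|/subnK<-].
elim: (i - k) => [|d IH] //; rewrite addSn /=; apply: contraNneq IH => e.
by apply/eqP/T_inj; rewrite ?lvl_O ?T_O // iter_k ?leq_addl.
Qed.

(** Equality up to sign: on the curve, equality of first coordinates, which is all that the sequence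
    u_i sees. *)
Let eqv p q := (p == q) || (p == neg q).

Let eqv_T p q : q \in S -> eqv p q -> eqv (T p) (T q).
Proof.
move=> qS; rewrite /eqv => /orP[]/eqP->; first by rewrite eqxx.
by rewrite T_neg // eqxx orbT.
Qed.

Let eqv_lvl j p q : p \in lvl j -> eqv p q -> q \in lvl j.
Proof. by move=> pj /orP[]/eqP e; subst p => //; rewrite -(negK q); apply: lvl_neg. Qed.

Let eqv_iter d i j : eqv (iter i T P) (iter j T P) ->
  eqv (iter (d + i) T P) (iter (d + j) T P).
Proof. by elim: d => // d IH /IH; apply: eqv_T. Qed.

Let eqv_inj p q : p \in lvl k -> q \in lvl k -> eqv (T p) (T q) -> eqv p q.
Proof.
move=> pk qk /orP[]/eqP e; first by rewrite /eqv (T_inj pk qk e) eqxx.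
rewrite -T_neg in e; last exact: lvl_sub qk.
by rewrite /eqv -(T_inj pk (lvl_neg qk) e) eqxx orbT.
Qed.

Let eqv_iter_inv d i j : k <= i -> k <= j -> eqv (iter (d + i) T P) (iter (d + j) T P) ->
  eqv (iter i T P) (iter j T P).
Proof.
move=> ki kj; elim: d => // d IH e; apply: IH; apply: eqv_inj => //;
  by apply: iter_k; lia.
Qed.

(** [r] is the least return time, up to sign, to the iterate of index [k]; it exists by the
    pigeonhole principle and injectivity of [T] on [lvl k]. *)
Lemma orbit_period : exists2 r, 0 < r &
  ((iter (r + k) T P == iter k T P) || (iter (r + k) T P == neg (iter k T P))) /\
  (forall i j, i < j -> j < r + k ->
    iter j T P != iter i T P /\ iter j T P != neg (iter i T P)).
Proof.
have ex : exists r, (0 < r) && eqv (iter (r + k) T P) (iter k T P).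
  pose f (i : 'I_#|X|.+1) := iter (i + k) T P.
  have /injectivePn[i [j nij e]] : ~~ injectiveb f.
    apply/negP => /injectiveP/leq_card.
    by rewrite card_ord ltnn.
  have [a [b [ab e']]] : exists a b, a < b /\ iter (b + k) T P = iter (a + k) T P.
    case: (ltngtP i j) => [ij|ji|/val_inj eij]; last by rewrite eij eqxx in nij.
      by exists i, j.
    by exists j, i.
  exists (b - a); rewrite subn_gt0 ab /=.
  apply: (@eqv_iter_inv a) => //; first by rewrite leq_addl.
  by rewrite addnA subnKC ?(ltnW ab) // e' /eqv eqxx.
exists (ex_minn ex); case: ex_minnP => r /andP[r0 re] rmin //; split=> // i j ij jr.
suff : ~~ eqv (iter j T P) (iter i T P) by rewrite negb_or => /andP.
apply/negP => e; case: (ltnP i k) => ik.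
  have [jk|kj] := ltnP j k.
    have := @eqv_iter (k - j) _ _ e; rewrite (subnK (ltnW jk)) => /(eqv_lvl (iter_k (leqnn k))).
    by apply/negP/iter_nk; lia.
  by have := eqv_lvl (iter_k kj) e; apply/negP/iter_nk.
(* For i >= k, pulling back by i - k steps gives the return time j - i < r. *)
have := rmin (j - i); rewrite subn_gt0 ij /=.
have -> : eqv (iter (j - i + k) T P) (iter k T P).
  apply: (@eqv_iter_inv (i - k)) => //; first by rewrite leq_addl.
  by rewrite addnCA (subnK ik) subnK // ltnW.
by move=> /(_ isT); lia.
Qed.

(** k = 0 is excluded since [O] is in the image of [T]; the iterate before [O] is in the kernel, and
    it is not [O] because its index is below [k]. *)
Lemma orbit_ker : iter k T P = O -> exists2 i, k = i.+1 & iter i T P = W \/ iter i T P = neg W.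
Proof.
case: k nWk Wk iter_nO => [|i] _ _ no; first by move=> /= e; move: nP; rewrite e -{1}T_O imset_f.
rewrite iterS => /(T_ker (iter_in_S i))[] e; exists i => //; [|by left|by right].
by have := no i (ltnSn i); rewrite e eqxx.
Qed.

End Orbit.

Theorem tripling_dichotomy P : P \in S -> P \notin T @: S ->
  exists k N, [/\ #|S| = 3 ^ k * N, ~~ (3 %| N) &
    (exists i, [/\ k = i.+1, iter i T P = W \/ iter i T P = neg W
       & forall j, j < k -> iter j T P != O]) \/
    (forall j, iter j T P != O) /\
    exists2 r, 0 < r &
      (iter (r + k) T P = iter k T P \/ iter (r + k) T P = neg (iter k T P)) /\
      (forall i j, i < j -> j < r + k ->
        iter j T P != iter i T P /\ iter j T P != neg (iter i T P))].
Proof.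
move=> PS nP; have [k [nWk Wk cS]] := depth_exists.
exists k, #|lvl k|; split; [exact: cS|exact: lvl_card_nW|].
have [e|ne] := eqVneq (iter k T P) O.
  left; have [i ki h] := orbit_ker nWk Wk PS nP e; exists i; split=> // j jk.
  exact: iter_nO jk.
right; split; first by move=> j; apply: (iter_O nWk Wk PS nP) ne.
have [r r0 [e h]] := orbit_period nWk Wk PS nP; exists r => //; split=> //.
by case/orP: e => /eqP; [left|right].
Qed.
End TriplingDynamics.

Local Open Scope ring_scope.

(** * The tripling map *)

Lemma mul3n (F : fieldType) (h3 : 3 = 0 :> F) n : (3 * n)%:R = 0 :> F.
Proof. by rewrite natrM h3 mul0r. Qed.

Lemma mul3nN (F : fieldType) (h3 : 3 = 0 :> F) n : - (3 * n)%:R = 0 :> F.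
Proof. by rewrite mul3n ?oppr0. Qed.

(* [ring: E] only rewrites coefficients syntactically equal to the left-hand
   side of [E], whence the explicit list of multiples of 3. *)
Ltac ring3 h := apply/eqP; rewrite -subr_eq0; apply/eqP;
  ring: (mul3n h 1) (mul3nN h 1) (mul3n h 2) (mul3nN h 2) (mul3n h 3)
        (mul3nN h 3) (mul3n h 4) (mul3nN h 4) (mul3n h 5) (mul3nN h 5)
        (mul3n h 6) (mul3nN h 6).

Ltac ring3h h e e' := apply/eqP; rewrite -subr_eq0; apply/eqP;
  ring: e e' (mul3n h 1) (mul3nN h 1) (mul3n h 2) (mul3nN h 2) (mul3n h 3)
        (mul3nN h 3) (mul3n h 4) (mul3nN h 4) (mul3n h 5) (mul3nN h 5)
        (mul3n h 6) (mul3nN h 6).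

Ltac field3 h := apply/eqP; rewrite -subr_eq0; apply/eqP;
  field: (mul3n h 1) (mul3nN h 1) (mul3n h 2) (mul3nN h 2) (mul3n h 3)
         (mul3nN h 3) (mul3n h 4) (mul3nN h 4) (mul3n h 5) (mul3nN h 5)
         (mul3n h 6) (mul3nN h 6) (mul3n h 7) (mul3nN h 7) (mul3n h 8)
         (mul3nN h 8) (mul3n h 9) (mul3nN h 9) (mul3n h 10) (mul3nN h 10)
         (mul3n h 11) (mul3nN h 11) (mul3n h 12) (mul3nN h 12)
         (mul3n h 13) (mul3nN h 13) (mul3n h 14) (mul3nN h 14)
         (mul3n h 15) (mul3nN h 15).

(** * The curve and its collinearity relation *)

Section Curve.
Variables (F : finFieldType) (h3 : 3 = 0 :> F).
Implicit Types (a c l n x y z u : F) (p q r : F * F) (P Q R : option (F * F)).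

Lemma cubeD x y : (x + y) ^+ 3 = x ^+ 3 + y ^+ 3.
Proof. by ring3 h3. Qed.

Lemma cubeN x : (- x) ^+ 3 = - x ^+ 3.
Proof. by ring. Qed.

Lemma cube_inj : injective (fun x : F => x ^+ 3).
Proof.
move=> x y /= e; have : (x - y) ^+ 3 == 0 by rewrite cubeD cubeN e subrr.
by rewrite expf_eq0 subr_eq0 => /eqP.
Qed.

Lemma sqr_eq1 (e : F) : e ^+ 2 = 1 -> e = 1 \/ e = -1.
Proof. by move/eqP; rewrite sqrf_eq1 => /orP[]/eqP; [left|right]. Qed.

Lemma two_neq0 : (2 : F) != 0.
Proof.
apply/eqP => h2; have : (1 : F) = 3 - 2 by ring.
by rewrite h3 h2 subr0 => /eqP; rewrite oner_eq0.
Qed.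

(* [None] is the point at infinity. *)
Definition onE a P := if P is Some p then p.2 ^+ 2 == p.1 ^+ 3 + p.1 ^+ 2 - a else true.
Definition pts a : {set option (F * F)} := [set P | onE a P].

(* The line y = l x + n meets y^2 = x^3 + x^2 - a in p, q, r, with
   multiplicity: x^3 + x^2 - a - (l x + n)^2 = (x - p.1) (x - q.1) (x - r.1). *)
Definition collin a l n p q r : bool :=
  [&& p.2 == l * p.1 + n, q.2 == l * q.1 + n, r.2 == l * r.1 + n,
      p.1 + q.1 + r.1 == l ^+ 2 - 1,
      p.1 * q.1 + q.1 * r.1 + r.1 * p.1 == l * n &
      p.1 * q.1 * r.1 == a + n ^+ 2].

Definition oppE p : F * F := (p.1, - p.2).
Definition neg P := omap oppE P.

(** P + Q + R = 0: the middle branch covers the vertical lines, and the line at infinity has triple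
    contact at [None]. *)
Definition col a P Q R : bool :=
  match P, Q, R with
  | Some p, Some q, Some r => [exists l, exists n, collin a l n p q r]
  | None, None, None => true
  | None, Some p, Some q | Some p, None, Some q | Some p, Some q, None => q == oppE p
  | _, _, _ => false
  end.

Lemma collinP a l n p q r : reflect
  [/\ [/\ p.2 = l * p.1 + n, q.2 = l * q.1 + n & r.2 = l * r.1 + n],
      p.1 + q.1 + r.1 = l ^+ 2 - 1,
      p.1 * q.1 + q.1 * r.1 + r.1 * p.1 = l * n &
      p.1 * q.1 * r.1 = a + n ^+ 2] (collin a l n p q r).
Proof.
apply: (iffP idP) => [/and5P[? ? ? ? /andP[? ?]]|].
  by split; [split|..]; apply/eqP.
by case=> -[e1 e2 e3] s1 s2 s3; rewrite /collin s1 s2 s3 e1 e2 e3 !eqxx.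
Qed.

Lemma colP a p q r :
  reflect (exists l n, collin a l n p q r) (col a (Some p) (Some q) (Some r)).
Proof.
apply: (iffP existsP) => [[l /existsP[n e]]|[l [n e]]]; first by exists l, n.
by exists l; apply/existsP; exists n.
Qed.

Lemma collin_onE a l n p q r : collin a l n p q r -> onE a (Some r).
Proof.
case/collinP=> -[_ _ e] s1 s2 s3; apply/eqP; rewrite e.
have -> : a = p.1 * q.1 * r.1 - n ^+ 2 by rewrite s3; ring.
apply/eqP; rewrite -subr_eq0; apply/eqP.
transitivity ((l * n - (p.1 * q.1 + q.1 * r.1 + r.1 * p.1)) * - r.1
  + (l ^+ 2 - 1 - (p.1 + q.1 + r.1)) * r.1 ^+ 2); first by ring3 h3.
by rewrite s1 s2; ring.
Qed.

Lemma oppEK : involutive oppE.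
Proof. by case=> x y; rewrite /oppE /= opprK. Qed.

Lemma oppE_swap p q : p == oppE q -> q == oppE p.
Proof. by move/eqP->; rewrite oppEK. Qed.

Lemma col_sym a P Q R : col a P Q R -> col a Q P R.
Proof.
case: P Q R => [p|] [q|] [r|] //; try exact: oppE_swap.
case/colP=> l [n /collinP[[e1 e2 e3] s1 s2 s3]].
apply/colP; exists l, n; apply/collinP; split=> //.
- by rewrite -s1; ring.
- by rewrite -s2; ring.
- by rewrite -s3; ring.
Qed.

Lemma collin_rot a l n p q r : collin a l n p q r -> collin a l n q r p.
Proof.
case/collinP=> -[e1 e2 e3] s1 s2 s3; apply/collinP; split=> //.
- by rewrite -s1; ring.
- by rewrite -s2; ring.
- by rewrite -s3; ring.
Qed.

Lemma col_rot a P Q R : col a P Q R -> col a Q R P.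
Proof.
case: P Q R => [p|] [q|] [r|] //; try exact: oppE_swap.
by case/colP=> l [n /collin_rot H]; apply/colP; exists l, n.
Qed.

Lemma col_neg a P : col a None P (neg P).
Proof. by case: P => [p|] //=. Qed.

(** Eliminating r from the second Vieta relation gives x = l y, the derivative of the equation in
    characteristic 3. If y = 0, then x = n = 0 and a = 0. *)
Lemma tangent a l n p q r : a != 0 -> collin a l n p q r -> p.1 = q.1 ->
  p.2 != 0 /\ p.1 = l * p.2.
Proof.
move=> a0 /collinP[[e1 e2 e3] s1 s2 s3] e.
have er : r.1 = l ^+ 2 - 1 - 2 * p.1 by rewrite -s1 -e; ring.
have el : p.1 = l * p.2.
  transitivity (p.1 - (p.1 * q.1 + q.1 * r.1 + r.1 * p.1 - l * n)).
    by rewrite s2; ring.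
  by rewrite -e er e1; ring3 h3.
split=> //; apply: contra_neq a0 => y0; have x0 : p.1 = 0 by rewrite el y0 mulr0.
have n0 : n = 0 by rewrite -y0 e1 x0 mulr0 add0r.
by move: s3; rewrite x0 n0 !mul0r expr0n addr0.
Qed.

Lemma col_vertical a p q r : a != 0 -> col a (Some p) (Some q) (Some r) ->
  q <> oppE p.
Proof.
move=> a0 /colP[l [n H]] e.
have [|y0 _] := tangent a0 H; first by rewrite e.
case/collinP: H => [[e1 e2 _] _ _ _]; case/eqP: y0.
have ey : - p.2 = p.2 by move: e2; rewrite e /= -e1.
transitivity (3 * p.2); last by rewrite h3 mul0r.
transitivity (p.2 + (p.2 + - p.2)); first by ring.
by rewrite ey; ring.
Qed.

(** The chord or tangent determines l, then a point on it gives n, and the sum of the roots gives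
    the third abscissa. *)
Lemma col_uniq a P Q R R' : a != 0 -> col a P Q R -> col a P Q R' -> R = R'.
Proof.
move=> a0; case: P Q R R' => [p|] [q|] [r|] [r'|] //;
  try by move=> /eqP-> /eqP->.
- case/colP=> l [n H]; case/colP=> l' [n' H'].
  have el : l = l'.
    have [e|ne] := eqVneq p.1 q.1.
      have [y0 el] := tangent a0 H e; have [_ el'] := tangent a0 H' e.
      by apply: (mulIf y0); rewrite -el.
    case/collinP: H => [[e1 e2 _] _ _ _]; case/collinP: H' => [[e1' e2' _] _ _ _].
    have ne' : p.1 - q.1 != 0 by rewrite subr_eq0.
    apply: (mulIf ne'); transitivity (p.2 - q.2); first by rewrite e1 e2; ring.
    by rewrite e1' e2'; ring.
  subst l'; case/collinP: H => [[e1 e2 e3] s1 s2 s3].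
  case/collinP: H' => [[e1' e2' e3'] s1' s2' s3'].
  have en : n = n' by apply: (addrI (l * p.1)); rewrite -e1.
  have er : r.1 = r'.1 by apply: (addrI (p.1 + q.1)); rewrite s1.
  by congr Some; rewrite [r]surjective_pairing [r']surjective_pairing e3 e3' er en.
- by move=> h /eqP e; case: (col_vertical a0 h e).
- by move=> /eqP e h; case: (col_vertical a0 h e).
Qed.

Lemma col_ex a P Q : P \in pts a -> Q \in pts a ->
  exists2 R, R \in pts a & col a P Q R.
Proof.
case: P Q => [p|] [q|]; rewrite !inE /=; last first.
- by exists None; rewrite ?inE.
- by move=> _ Sq; exists (neg (Some q)); rewrite ?inE /= ?sqrrN.
- by move=> Sp _; exists (neg (Some p)); rewrite ?inE /= ?sqrrN.
case: p q => [x1 y1] [x2 y2] /= /eqP E1 /eqP E2.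
(* The second condition equates the divided differences at x1, x2 of (l x + n)^2 and x^3 + x^2, so
   it serves chord and tangent alike. *)
suff key l : y2 = l * x2 + (y1 - l * x1) ->
    l ^+ 2 * (x1 + x2) + 2 * l * (y1 - l * x1) = x1 ^+ 2 + x1 * x2 + x2 ^+ 2 + x1 + x2 ->
    exists2 R, R \in pts a & col a (Some (x1, y1)) (Some (x2, y2)) R.
  have [ex|nx] := eqVneq x1 x2.
    subst x2; have [ey|ny] := eqVneq y2 (- y1).
      by exists None; rewrite ?inE //= ey.
    have ey : y2 = y1.
      have /eqP : (y2 - y1) * (y2 + y1) = 0 by rewrite -subr_sqr E1 E2 subrr.
      by rewrite mulf_eq0 subr_eq0 addr_eq0 (negPf ny) orbF => /eqP.
    subst y2; have y0 : y1 != 0.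
      by apply: contra_neq ny => ->; rewrite oppr0.
    (* The tangent slope (3 x^2 + 2 x) / (2 y) is x / y in characteristic 3. *)
    apply: (key (x1 / y1)); first by ring.
    by field3 h3.
  have nx' : x1 - x2 != 0 by rewrite subr_eq0.
  apply: (key ((y1 - y2) / (x1 - x2))); first by field.
  set l := (y1 - y2) / (x1 - x2).
  have el : y1 = l * (x1 - x2) + y2 by rewrite /l divfK // subrK.
  apply: (mulIf nx').
  transitivity (y1 ^+ 2 - y2 ^+ 2); first by rewrite {2}el; ring: el.
  by rewrite E1 E2; ring.
set n := y1 - l * x1 => e2 H.
have e1 : y1 = l * x1 + n by rewrite /n; ring.
clearbody n; pose x3 := l ^+ 2 - 1 - x1 - x2.
have C : collin a l n (x1, y1) (x2, y2) (x3, l * x3 + n).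
  apply/collinP; split=> //=.
  - by rewrite /x3; ring.
  - transitivity (l ^+ 2 * (x1 + x2) + 2 * l * n - (x1 ^+ 2 + x1 * x2 + x2 ^+ 2 + x1 + x2) + l * n).
      by rewrite /x3; ring3 h3.
    by rewrite H; ring.
  - have -> : a = x1 ^+ 3 + x1 ^+ 2 - y1 ^+ 2 by rewrite E1; ring.
    transitivity (x1 * (l ^+ 2 * (x1 + x2) + 2 * l * n - (x1 ^+ 2 + x1 * x2 + x2 ^+ 2 + x1 + x2))
      + (x1 ^+ 3 + x1 ^+ 2 - y1 ^+ 2 + n ^+ 2)).
      by rewrite /x3 e1; ring3 h3.
    by rewrite H; ring.
exists (Some (x3, l * x3 + n)); last by apply/colP; exists l, n.
by rewrite inE; apply: collin_onE C.
Qed.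

(** * Isogeny, Frobenius and the fibres of their composite *)

Section Tripling.
Variables (c : F) (c0 : c != 0).
Local Notation a := (c ^+ 3).

Definition slope p := p.2 / (p.1 - c).
(** [ver] stands for Verschiebung, the isogeny from E(c^3) to E(c); the cubes in [trip] are the
    Frobenius back to E(c^3). *)
Definition ver_x p := slope p ^+ 2 - 1 - c / (p.1 - c).
Definition ver_y p := slope p ^+ 3 - slope p.
Definition trip P : option (F * F) :=
  if P is Some p then
    if p.1 == c then None else Some (ver_x p ^+ 3, ver_y p ^+ 3)
  else None.
Definition W : option (F * F) := Some (c, c).

Lemma a_neq0 : a != 0. Proof. by rewrite expf_neq0. Qed.

(** With t = x - c the equation is y^2 = t^3 + (t + c)^2; divide by t^2 and use 2 = -1. *)
Lemma slope_sqr p : p.1 != c -> onE a (Some p) ->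
  slope p ^+ 2 = (p.1 - c) + 1 - c / (p.1 - c) + c ^+ 2 / (p.1 - c) ^+ 2.
Proof.
rewrite -subr_eq0 => t0 /eqP E; rewrite /slope expr_div_n E.
by field3 h3.
Qed.

Lemma ver_onE p : p.1 != c -> onE a (Some p) -> onE c (Some (ver_x p, ver_y p)).
Proof.
move=> pc /(slope_sqr pc) z2; rewrite -subr_eq0 in pc; apply/eqP => /=.
transitivity (slope p ^+ 2 * (slope p ^+ 2 - 1) ^+ 2); first by rewrite /ver_y; ring.
(* With w = c / t and c = w t the claim becomes a polynomial identity in t and w. *)
rewrite /ver_x z2 -expr_div_n; set t := p.1 - c; set w := c / t.
have -> : c = w * t by rewrite divfK.
by ring3 h3.
Qed.

Lemma trip_pts P : P \in pts a -> trip P \in pts a.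
Proof.
rewrite !inE; case: P => //= p E; case: eqVneq => // pc /=.
have /eqP /= e := ver_onE pc E; apply/eqP.
move: (ver_x p) (ver_y p) e => u v e.
by rewrite exprAC e !(cubeD, cubeN) [u ^+ 2 ^+ 3]exprAC.
Qed.

(** Identifies the recursion with the first coordinate of [trip], since u^3 - c^3 = (u - c)^3. *)
Lemma trip_ustep p : p.1 != c -> onE a (Some p) -> ver_x p ^+ 3 = ustep a p.1.
Proof.
move=> pc /(slope_sqr pc) z2; have ea : p.1 ^+ 3 - a = (p.1 - c) ^+ 3.
  by rewrite cubeD cubeN.
rewrite -subr_eq0 in pc; rewrite /ver_x /ustep ea z2.
rewrite -expr_div_n; set t := p.1 - c; rewrite -/t in pc.
have -> : p.1 = t + c by rewrite subrK.
set w := c / t; have -> : c = w * t by rewrite divfK.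
by rewrite cubeD; field3 h3.
Qed.

(* The point over (u, z^3 - z) at which [slope] takes the value z. *)
Definition ver_inv u z : F * F :=
  (c + c / (z ^+ 2 - 1 - u), z * (c / (z ^+ 2 - 1 - u))).

(** If u = z^2 - 1 then u^3 + u^2 = (z^3 - z)^2, and the equation of E(c) forces c = 0. *)
Lemma ver_inv_den u z : onE c (Some (u, z ^+ 3 - z)) -> z ^+ 2 - 1 - u != 0.
Proof.
move=> /eqP /= E; apply: contra_neq c0 => den0.
have eu : u = z ^+ 2 - 1 by rewrite -[RHS](subrK u) den0 add0r.
have -> : c = u ^+ 3 + u ^+ 2 - (z ^+ 3 - z) ^+ 2 by rewrite E; ring.
by rewrite eu; ring.
Qed.

Lemma ver_inv_nker u z : onE c (Some (u, z ^+ 3 - z)) -> (ver_inv u z).1 != c.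
Proof.
move=> /ver_inv_den den0; rewrite -subr_eq0 /= [_ - c]addrC addKr.
by rewrite mulf_neq0 // invr_neq0.
Qed.

Lemma slope_inv u z : onE c (Some (u, z ^+ 3 - z)) -> slope (ver_inv u z) = z.
Proof.
move=> /ver_inv_den den0; rewrite /slope /= [_ - c]addrC addKr mulfK //.
by rewrite mulf_neq0 // invr_neq0.
Qed.

Lemma ver_x_inv u z : onE c (Some (u, z ^+ 3 - z)) -> ver_x (ver_inv u z) = u.
Proof.
move=> E; rewrite /ver_x slope_inv //= [_ - c]addrC addKr.
by have den0 := ver_inv_den E; field; rewrite den0 c0.
Qed.

Lemma ver_y_inv u z : onE c (Some (u, z ^+ 3 - z)) ->
  ver_y (ver_inv u z) = z ^+ 3 - z.
Proof. by move=> E; rewrite /ver_y slope_inv. Qed.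

Lemma ver_inv_onE u z : onE c (Some (u, z ^+ 3 - z)) -> onE a (Some (ver_inv u z)).
Proof.
move=> E; have den0 := ver_inv_den E; move/eqP: E => /= E; apply/eqP => /=.
set D := z ^+ 2 - 1 - u in den0 *.
have eu : u = z ^+ 2 - 1 - D by rewrite /D; ring.
have e : c = u ^+ 3 + u ^+ 2 - (z ^+ 3 - z) ^+ 2 by rewrite E; ring.
apply/eqP; rewrite -subr_eq0; apply/eqP.
(* The defect in the equation of E(c^3) is the defect in that of E(c) times -c^2 / D^3. *)
transitivity ((c - (u ^+ 3 + u ^+ 2 - (z ^+ 3 - z) ^+ 2)) * (- c ^+ 2 / D ^+ 3)).
  by rewrite eu; field3 h3.
by rewrite {1}e subrr mul0r.
Qed.

Lemma ver_invK p : p.1 != c -> onE a (Some p) -> ver_inv (ver_x p) (slope p) = p.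
Proof.
move=> pc E; rewrite -subr_eq0 in pc; rewrite /ver_inv.
have -> : slope p ^+ 2 - 1 - ver_x p = c / (p.1 - c) by rewrite /ver_x; ring.
have -> : c / (c / (p.1 - c)) = p.1 - c by field; rewrite pc c0.
by rewrite addrC subrK /slope divfK // -surjective_pairing.
Qed.

(** z^3 - z is additive, so z - z' is a root of e^3 - e; the disjunction says that e lies in F_3. *)
Lemma artin_schreier_fiber z z' : z' ^+ 3 - z' = z ^+ 3 - z ->
  exists2 e : F, z' = z - e & e = 0 \/ e ^+ 2 = 1.
Proof.
move=> e; exists (z - z'); first by ring.
have : (z - z') * ((z - z') ^+ 2 - 1) = 0.
  transitivity (z ^+ 3 - z - (z' ^+ 3 - z')); first by ring3 h3.
  by rewrite e subrr.
move/eqP; rewrite mulf_eq0 [X in _ || X]subr_eq0.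
by case/orP=> /eqP; [left|right].
Qed.

Lemma ker_onE p : p.1 = c -> onE a (Some p) -> exists2 e : F, p = (c, e * c) & e ^+ 2 = 1.
Proof.
move=> pc /eqP E; exists (p.2 / c).
  by rewrite divfK // -pc -surjective_pairing.
rewrite expr_div_n E pc; by field.
Qed.

Lemma trip_ker P : P \in pts a -> trip P = None -> [\/ P = None, P = W | P = neg W].
Proof.
rewrite inE; case: P => [p E|_ _]; last exact: Or31.
rewrite /trip; case: eqVneq => // pc _.
have [e -> /sqr_eq1[]->] := ker_onE pc E; rewrite ?mul1r ?mulN1r.
  exact: Or32.
exact: Or33.
Qed.

Lemma W_pts : W \in pts a.
Proof. by rewrite inE /=; apply/eqP; ring. Qed.

Lemma neg_pts P : P \in pts a -> neg P \in pts a.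
Proof. by rewrite !inE; case: P => //= p; rewrite sqrrN. Qed.

Lemma trip_inv u z : onE c (Some (u, z ^+ 3 - z)) ->
  trip (Some (ver_inv u z)) = Some (u ^+ 3, (z ^+ 3 - z) ^+ 3).
Proof.
by move=> E; rewrite /trip (negPf (ver_inv_nker E)) ver_x_inv // ver_y_inv.
Qed.

(** Cubing is injective, so the images on E(c) agree and the slopes differ by an element of F_3;
    [ver_inv] recovers a point from its slope. *)
Lemma trip_eq_inv p Q : p.1 != c -> Q \in pts a -> trip Q = trip (Some p) ->
  exists2 e : F, Q = Some (ver_inv (ver_x p) (slope p - e)) & e = 0 \/ e ^+ 2 = 1.
Proof.
rewrite inE; case: Q => [q|]; rewrite /trip => /negPf -> //.
case: eqVneq => // qc E [/cube_inj eu /cube_inj ev].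
have [e ez e2] := artin_schreier_fiber ev; exists e => //.
by rewrite -ez -eu ver_invK.
Qed.

Lemma slope_shift (e : F) z : e = 0 \/ e ^+ 2 = 1 ->
  (z - e) ^+ 3 - (z - e) = z ^+ 3 - z.
Proof.
move=> he; have e3 : e ^+ 3 = e.
  by case: he => [->|e2]; rewrite ?expr0n // exprS e2 mulr1.
by rewrite cubeD cubeN e3; ring.
Qed.

(** Shifting the slope by e is translation by a kernel point. In terms of t, z and w = c / t, the
    Vieta relations reduce to e^2 = 1 and z^2 = t + 1 - w + w^2. *)
Lemma col_fiber (e : F) p : e ^+ 2 = 1 -> p.1 != c -> onE a (Some p) ->
  col a (Some p) (Some (oppE (ver_inv (ver_x p) (slope p - e)))) (Some (c, e * c)).
Proof.
move=> e2 pc E; have z2 := slope_sqr pc E.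
have E' : onE c (Some (ver_x p, (slope p - e) ^+ 3 - (slope p - e))).
  by rewrite slope_shift; [apply: ver_onE|right].
have := ver_inv_den E'; rewrite /ver_inv /oppE /=.
rewrite -subr_eq0 in pc.
have e1 : p.1 = p.1 - c + c by rewrite subrK.
have ey : p.2 = slope p * (p.1 - c) by rewrite /slope divfK.
move: e1 ey z2; rewrite /ver_x; move: (p.1 - c) (slope p) pc => t z t0.
rewrite [p]surjective_pairing /= => -> -> .
set w := c / t; have -> : c ^+ 2 / t ^+ 2 = w ^+ 2 by rewrite -expr_div_n.
have ec : c = w * t by rewrite divfK.
move=> z2 d0.
have ed : (z - e) ^+ 2 - 1 - (z ^+ 2 - 1 - w) = e * z + 1 + w.
  transitivity (e * z + e ^+ 2 + w); last by rewrite e2.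
  by ring3 h3.
rewrite ed in d0 *.
(* This factorization of t removes the denominator e z + 1 + w. *)
have et : (e * z + 1 + w) * (e * z - 1 - w) = t.
  transitivity (e ^+ 2 * z ^+ 2 - (1 + w) ^+ 2); first by ring.
  by rewrite e2 z2; ring3 h3.
have -> : c / (e * z + 1 + w) = w * (e * z - 1 - w).
  by rewrite ec -et; field.
(* The chord through p and (c, e c) has slope (z t - e c) / t = z - e w. *)
apply/colP; exists (z - e * w), (e * c - (z - e * w) * c).
have z2' : z ^+ 2 = t + 1 - w + w ^+ 2 := z2.
apply/collinP; split; [split|..]; rewrite /= ec.
- by ring.
- by ring3h h3 e2 z2'.
- by ring.
- by ring3h h3 e2 z2'.
- by ring3h h3 e2 z2'.
- by ring3h h3 e2 z2'.
Qed.

Lemma trip_eq P Q : P \in pts a -> Q \in pts a -> trip P = trip Q ->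
  [\/ P = Q, col a P (neg Q) W | col a P (neg Q) (neg W)].
Proof.
case: P => [p|]; last first.
  move=> _ SQ /esym /(trip_ker SQ)[->|->|->]; [exact: Or31|apply: Or32|apply: Or33];
    by rewrite /= oppEK.
case: (eqVneq p.1 c) => [pc SP SQ e|pc SP SQ /esym e].
  have Tp : trip (Some p) = None by rewrite /trip pc eqxx.
  rewrite Tp in e; case: (trip_ker SQ (esym e)) => ->;
    case: (trip_ker SP Tp) => // ->; try exact: Or31.
  - by apply: Or33; apply/eqP.
  - by apply: Or32; rewrite /= /oppE /= opprK.
  (* y = -x and, below, y = x are the inflectional tangents at [neg W] and [W]. *)
  - apply: Or33; apply/colP; exists (-1), 0; apply/collinP.
    by split; [split|..]; rewrite /=; ring3 h3.
  - apply: Or32; apply/colP; exists 1, 0; apply/collinP.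
    by split; [split|..]; rewrite /= ?opprK; ring3 h3.
have E : onE a (Some p) by move: SP; rewrite inE.
have [d -> [->|d2]] := trip_eq_inv pc SQ e.
  by apply: Or31; rewrite subr0 ver_invK.
have := col_fiber d2 pc E; case: (sqr_eq1 d2) => -> C.
  by apply: Or32; rewrite mul1r in C.
by apply: Or33; rewrite mulN1r in C.
Qed.

Lemma one_neqN1 : (1 : F) != -1.
Proof. by rewrite -subr_eq0 opprK two_neq0. Qed.

(** Over [None] the fibre is the kernel; elsewhere its points have the three slopes z, z - 1 and z +
    1. *)
Lemma trip_fiber P : P \in pts a ->
  #|[set Q in pts a | trip Q == trip P]| = 3%N.
Proof.
move=> SP; have [TP|] := eqVneq (trip P) None.
  transitivity #|[set None; W; neg W]|.
    rewrite TP; apply: eq_card => Q; rewrite !inE -/(onE a Q); apply/idP/idP.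
      case/andP=> SQ /eqP/trip_ker; rewrite inE => /(_ SQ)[] ->; by rewrite eqxx ?orbT.
    case/orP=> [/orP[]|] /eqP->; rewrite /= ?eqxx ?andbT //.
      by have := W_pts; rewrite inE.
    by have := neg_pts W_pts; rewrite inE.
  rewrite -setUA cardsU1 cards2 !inE /=.
  suff -> : W != neg W by [].
  apply/eqP => -[/eqP]; rewrite -addr_eq0 -mulr2n -mulr_natl.
  by rewrite mulf_eq0 (negPf two_neq0) (negPf c0).
case: P SP => [p|//] SP TP; have pc : p.1 != c by apply: contraNneq TP => e; rewrite /trip e eqxx.
have E : onE a (Some p) by move: SP; rewrite inE.
pose f (e : F) := Some (ver_inv (ver_x p) (slope p - e)).
have Ef e : e = 0 \/ e ^+ 2 = 1 ->
    onE c (Some (ver_x p, (slope p - e) ^+ 3 - (slope p - e))).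
  by move=> he; rewrite slope_shift //; apply: ver_onE.
have fin e : e = 0 \/ e ^+ 2 = 1 -> f e \in [set Q in pts a | trip Q == trip (Some p)].
  move=> he; rewrite !inE -/(onE a (f e)) ver_inv_onE ?Ef // trip_inv ?Ef //.
  by rewrite slope_shift // /trip (negPf pc) eqxx.
have finj e e' : e = 0 \/ e ^+ 2 = 1 -> e' = 0 \/ e' ^+ 2 = 1 -> f e = f e' -> e = e'.
  move=> he he' [] /(congr1 (fun x => x)) ee eo.
  apply: oppr_inj; apply: (addrI (slope p)).
  rewrite -[LHS](slope_inv (Ef _ he)) -[RHS](slope_inv (Ef _ he')).
  by congr slope; rewrite /ver_inv ee eo.
have sq0 : (0 : F) = 0 \/ (0 : F) ^+ 2 = 1 by left.
have sq1 : (1 : F) = 0 \/ (1 : F) ^+ 2 = 1 by right; rewrite expr1n.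
have sqN : (-1 : F) = 0 \/ (-1 : F) ^+ 2 = 1 by right; rewrite sqrrN expr1n.
transitivity #|[set f 0; f 1; f (-1)]|.
  apply: eq_card => Q; apply/idP/idP.
    case/setIdP=> SQ /eqP e.
    have [d -> hd] := trip_eq_inv pc SQ e; rewrite !inE.
    by case: hd => [->|/sqr_eq1[]->]; rewrite eqxx ?orbT.
  by case/setUP=> [/set2P[]|/set1P] ->; apply: fin.
rewrite -setUA cardsU1 cards2 !inE negb_or.
have -> : f 0 != f 1 by apply/eqP => /(finj _ _ sq0 sq1)/eqP; rewrite eq_sym oner_eq0.
have -> : f 0 != f (-1).
  by apply/eqP => /(finj _ _ sq0 sqN)/eqP; rewrite eq_sym oppr_eq0 oner_eq0.
by have -> : f 1 != f (-1) by apply/eqP => /(finj _ _ sq1 sqN)/eqP; rewrite (negPf one_neqN1).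
Qed.

(** A triple root makes the first two symmetric functions vanish in characteristic 3, so l^2 = 1 and
    n = 0; the third then gives x^3 = c^3. *)
Lemma col_flex P : P \in pts a -> col a P P P -> [\/ P = None, P = W | P = neg W].
Proof.
move=> SP; case: P SP => [p|] SP; last by move=> _; apply: Or31.
case/colP=> l [n /collinP[[e1 _ _] s1 s2 s3]].
have l2 : l ^+ 2 = 1.
  by rewrite -[LHS](subrK 1) -s1; ring3 h3.
have n0 : n = 0.
  have : l * n = 0 by rewrite -s2; ring3 h3.
  move/eqP; rewrite mulf_eq0 => /orP[/eqP l0|/eqP //].
  by move/eqP: l2; rewrite l0 expr0n eq_sym oner_eq0.
have pc : p.1 = c.
  by apply: cube_inj; move: s3; rewrite n0 expr0n addr0 => <-; ring.
rewrite [p]surjective_pairing e1 pc n0 addr0.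
by case: (sqr_eq1 l2) => ->; rewrite ?mul1r ?mulN1r; [apply: Or32|apply: Or33].
Qed.

Lemma trip_neg P : trip (neg P) = neg (trip P).
Proof.
case: P => [p|] //=; case: eqP => // _.
have sN : slope (oppE p) = - slope p by rewrite /slope /= mulNr.
by rewrite /ver_x /ver_y sN /oppE /= sqrrN cubeN -opprD cubeN.
Qed.

Lemma collin_cube l n p q r : collin c l n p q r ->
  collin a (l ^+ 3) (n ^+ 3) (p.1 ^+ 3, p.2 ^+ 3) (q.1 ^+ 3, q.2 ^+ 3)
    (r.1 ^+ 3, r.2 ^+ 3).
Proof.
case/collinP=> -[e1 e2 e3] s1 s2 s3; apply/collinP; split; [split|..] => /=.
- by rewrite e1 cubeD exprMn.
- by rewrite e2 cubeD exprMn.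
- by rewrite e3 cubeD exprMn.
- by rewrite -!cubeD s1 cubeD cubeN expr1n exprAC.
- by rewrite -!exprMn -!cubeD s2 exprMn.
- by rewrite -!exprMn s3 cubeD exprAC.
Qed.

(** * The isogeny maps lines to lines *)

Section Line.
Variables (l n : F) (p q r : F * F).
Hypothesis pqr : collin a l n p q r.
(** In t = x - c the line is y = l t + d, and the abscissas are the roots of t^3 - (l^2 - 1) t^2 +
    (l d - c) t - (d^2 - c^2). *)
Let d := l * c + n.

Let sumt : (p.1 - c) + (q.1 - c) + (r.1 - c) = l ^+ 2 - 1.
Proof. by case/collinP: pqr => _ <- _ _; ring3 h3. Qed.

Let sumtt : (p.1 - c) * (q.1 - c) + (q.1 - c) * (r.1 - c) + (r.1 - c) * (p.1 - c) = l * d - c.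
Proof.
case/collinP: pqr => _ s1 s2 _.
transitivity (l * n - 2 * c * (l ^+ 2 - 1) + 3 * c ^+ 2); last by rewrite /d; ring3 h3.
by rewrite -s1 -s2; ring.
Qed.

Let prodt : (p.1 - c) * (q.1 - c) * (r.1 - c) = d ^+ 2 - c ^+ 2.
Proof.
case/collinP: pqr => _ s1 s2 s3.
transitivity (a + n ^+ 2 - c * (l * n) + c ^+ 2 * (l ^+ 2 - 1) - c ^+ 3).
  by rewrite -s1 -s2 -s3; ring.
by rewrite /d; ring3 h3.
Qed.

Let slopeE (x y : F) : y = l * x + n -> x - c != 0 -> slope (x, y) = l + d / (x - c).
Proof. by move=> -> t0; rewrite /slope /= /d; field. Qed.

Lemma ver_collin : p.1 != c -> q.1 != c -> r.1 != c ->
  exists L N, collin c L N (ver_x p, ver_y p) (ver_x q, ver_y q) (ver_x r, ver_y r).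
Proof.
rewrite -!(subr_eq0 _ c) => tp tq tr.
have D0 : d ^+ 2 - c ^+ 2 != 0 by rewrite -prodt !mulf_neq0.
case/collinP: pqr => -[e1 e2 e3] _ _ _.
have zp := slopeE e1 tp; have zq := slopeE e2 tq; have zr := slopeE e3 tr.
rewrite -!surjective_pairing in zp zq zr.
set D := d ^+ 2 - c ^+ 2.
(* Comparing coefficients of 1 / t^2 and 1 makes [ver_y] - L [ver_x] - N equal to -d^3 / D times the
   cubic in t over t^3. *)
pose L := d * (l * d - c) / D.
pose N := l ^+ 3 - l - L * (l ^+ 2 - 1) + d ^+ 3 / D.
pose A := l ^+ 2 - 1; pose B := 2 * l * d - c; pose G := d ^+ 2.
have xE t : (l + d / t) ^+ 2 - 1 - c / t = A + B / t + G * t^-1 ^+ 2.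
  by rewrite /A /B /G; ring.
exists L, N; move: sumt sumtt prodt zp zq zr.
rewrite /ver_x /ver_y.
move: (p.1 - c) (q.1 - c) (r.1 - c) (slope p) (slope q) (slope r) tp tq tr.
move=> t1 t2 t3 _ _ _ t10 t20 t30 S1 S2 S3 -> -> ->.
have on_line t : t != 0 -> (t - t1) * (t - t2) * (t - t3) = 0 ->
    (l + d / t) ^+ 3 - (l + d / t) = L * ((l + d / t) ^+ 2 - 1 - c / t) + N.
  move=> t0 root.
  have cubic : t ^+ 3 - (l ^+ 2 - 1) * t ^+ 2 + (l * d - c) * t - D = 0.
    by rewrite /D -S1 -S2 -S3 -[RHS]root; ring.
  apply/eqP; rewrite -subr_eq0; apply/eqP.
  transitivity (- d ^+ 3 / D * (t ^+ 3 - (l ^+ 2 - 1) * t ^+ 2 + (l * d - c) * t - D) / t ^+ 3).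
    by rewrite /N /L /D; field3 h3; rewrite t0.
  by rewrite cubic mulr0 mul0r.
(* The reciprocals w of the roots satisfy the reversed cubic; the new abscissas are A + B w + G w^2,
   expanded below in symmetric functions of the w. *)
have s1 : t1^-1 + t2^-1 + t3^-1 = (l * d - c) / D.
  by rewrite -S2 /D -S3; field; rewrite t10 t20 t30.
have s2 : t1^-1 * t2^-1 + t2^-1 * t3^-1 + t3^-1 * t1^-1 = (l ^+ 2 - 1) / D.
  by rewrite -S1 /D -S3; field; rewrite t10 t20 t30.
have s3 : t1^-1 * t2^-1 * t3^-1 = 1 / D.
  by rewrite /D -S3; field; rewrite t10 t20 t30.
apply/collinP; split; [split|..]; rewrite /=.
- by apply: on_line => //; rewrite subrr !mul0r.
- by apply: on_line => //; rewrite subrr mulr0 mul0r.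
- by apply: on_line => //; rewrite subrr mulr0.
all: rewrite !xE; move: s1 s2 s3; move: (t1^-1) (t2^-1) (t3^-1) => w1 w2 w3 s1 s2 s3.
- transitivity (3 * A + B * (w1 + w2 + w3)
    + G * ((w1 + w2 + w3) ^+ 2 - 2 * (w1 * w2 + w2 * w3 + w3 * w1))); first by ring.
  by rewrite s1 s2 /A /B /G /L /D; field3 h3.
- transitivity (3 * A ^+ 2 + 2 * A * (B * (w1 + w2 + w3)
      + G * ((w1 + w2 + w3) ^+ 2 - 2 * (w1 * w2 + w2 * w3 + w3 * w1)))
    + B ^+ 2 * (w1 * w2 + w2 * w3 + w3 * w1)
    + B * G * ((w1 + w2 + w3) * (w1 * w2 + w2 * w3 + w3 * w1) - 3 * (w1 * w2 * w3))
    + G ^+ 2 * ((w1 * w2 + w2 * w3 + w3 * w1) ^+ 2 - 2 * (w1 + w2 + w3) * (w1 * w2 * w3))).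
    by ring.
  by rewrite s1 s2 s3 /A /B /G /L /N /L /D; field3 h3.
- transitivity (A ^+ 3 + A ^+ 2 * (B * (w1 + w2 + w3)
      + G * ((w1 + w2 + w3) ^+ 2 - 2 * (w1 * w2 + w2 * w3 + w3 * w1)))
    + A * (B ^+ 2 * (w1 * w2 + w2 * w3 + w3 * w1)
    + B * G * ((w1 + w2 + w3) * (w1 * w2 + w2 * w3 + w3 * w1) - 3 * (w1 * w2 * w3))
    + G ^+ 2 * ((w1 * w2 + w2 * w3 + w3 * w1) ^+ 2 - 2 * (w1 + w2 + w3) * (w1 * w2 * w3)))
    + w1 * w2 * w3 * (B ^+ 3 + B ^+ 2 * G * (w1 + w2 + w3)
    + B * G ^+ 2 * (w1 * w2 + w2 * w3 + w3 * w1) + G ^+ 3 * (w1 * w2 * w3))).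
    by ring.
  by rewrite s1 s2 s3 /A /B /G /L /N /L /D; field3 h3.
Qed.

(** The root t = 0 gives d = e c with e^2 = 1. If l = e, the line is an inflectional tangent and q,
    r are in the kernel too. Otherwise the slopes of q and r add up to e, and e^3 - e = 0 makes the
    images opposite. *)
Lemma ker_collin : p.1 = c ->
  col a None (trip (Some q)) (trip (Some r)).
Proof.
move=> pc; have := sumt; have := sumtt; have := prodt.
rewrite pc subrr !mul0r mulr0 add0r add0r addr0 => /esym/eqP.
rewrite subr_eq0 => /eqP dc S2 S1.
have [e de e2] : exists2 e, d = e * c & e ^+ 2 = 1.
  by exists (d / c); [rewrite divfK|rewrite expr_div_n dc divff // expf_neq0].
have l1 : l * d - c = e * c * (l - e).
  by transitivity (l * (e * c) - e ^+ 2 * c); [rewrite e2 de; ring|ring].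
have l2 : l ^+ 2 - 1 = (l - e) * (l + e) by rewrite -e2; ring.
rewrite l1 l2 in S1 S2.
case/collinP: pqr => -[_ e2' e3'] _ _ _; rewrite /trip.
have e0 : e != 0 by apply/eqP => e0; move/eqP: e2; rewrite e0 expr0n eq_sym oner_eq0.
have [le|le] := eqVneq (l - e) 0.
  move: S1 S2; rewrite le mul0r mulr0 => /eqP S1 /eqP S2.
  have rq : r.1 - c == 0.
    by move: S2 S1; rewrite mulf_eq0 => /orP[/eqP->|//]; rewrite add0r.
  move: S1; rewrite (eqP rq) addr0 subr_eq0 => ->.
  by rewrite subr_eq0 in rq; rewrite rq.
have : (q.1 - c) * (r.1 - c) != 0 by rewrite S2 !mulf_neq0.
rewrite mulf_eq0 negb_or => /andP[qc rc].
rewrite -!(subr_eq0 _ c) (negPf qc) (negPf rc).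
have zq := slopeE e2' qc; have zr := slopeE e3' rc.
rewrite -!surjective_pairing in zq zr.
suff [ex ey] : ver_x r = ver_x q /\ ver_y r = - ver_y q.
  by rewrite /= /oppE /= ex ey cubeN.
have zz : slope q + slope r = e.
  rewrite zq zr; transitivity (2 * l + d * ((q.1 - c) + (r.1 - c)) / ((q.1 - c) * (r.1 - c))).
    by field; rewrite qc rc.
  rewrite S1 S2 de; transitivity (3 * l + e); last by rewrite h3 mul0r add0r.
  by field; rewrite e0 c0 le.
have -> : ver_y r = - ver_y q.
  have -> : ver_y r = e ^+ 3 - e - ver_y q.
    by rewrite /ver_y -zz; ring3 h3.
  by rewrite exprS e2 mulr1 subrr sub0r.
split=> //; apply/eqP; rewrite -subr_eq0; apply/eqP.
transitivity ((slope r - slope q) * (slope q + slope r) - c * ((r.1 - c)^-1 - (q.1 - c)^-1)).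
  by rewrite /ver_x; ring.
rewrite zz zq zr de; transitivity ((e ^+ 2 - 1) * c * ((r.1 - c)^-1 - (q.1 - c)^-1)).
  by ring.
by rewrite e2 subrr !mul0r.
Qed.

End Line.

Lemma trip_col P Q R : col a P Q R -> col a (trip P) (trip Q) (trip R).
Proof.
have neg_eq p q : q == oppE p -> Some q = neg (Some p) by move/eqP->.
case: P Q R => [p|] [q|] [r|] //; last first.
- by move/neg_eq=> ->; rewrite trip_neg; apply: col_neg.
- by move/neg_eq=> ->; rewrite trip_neg; apply/col_sym/col_neg.
- by move/neg_eq=> ->; rewrite trip_neg; apply/col_rot/col_neg.
case/colP=> l [n H].
have [pc|pc] := eqVneq p.1 c; first by rewrite {1}/trip pc eqxx (ker_collin H).
have [qc|qc] := eqVneq q.1 c.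
  by apply/col_rot/col_rot; rewrite {1}/trip qc eqxx (ker_collin (collin_rot H)).
have [rc|rc] := eqVneq r.1 c.
  apply/col_rot; rewrite {1}/trip rc eqxx.
  exact: (ker_collin (collin_rot (collin_rot H))).
have [L [N H']] := ver_collin H pc qc rc.
rewrite /trip (negPf pc) (negPf qc) (negPf rc); apply/colP.
by exists (L ^+ 3), (N ^+ 3); apply: collin_cube H'.
Qed.

End Tripling.
End Curve.

(** * Point count and Kloosterman sum *)

Section Sqrt.
Variables (F : finFieldType) (two0 : (2 : F) != 0).
Implicit Types x y t w : F.

(** 1 + chi(t) for the quadratic character chi, kept as a natural number. *)
Definition nsqrt t := #|[set w : F | w ^+ 2 == t]|.

Lemma nsqrt0 : nsqrt 0 = 1%N.
Proof.
rewrite -(cards1 (0 : F)); apply: eq_card => w.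
by rewrite !inE expf_eq0.
Qed.

Lemma nsqrt_sqr w : w != 0 -> nsqrt (w ^+ 2) = 2%N.
Proof.
move=> w0; transitivity #|[set w; - w]|.
  by apply: eq_card => v; rewrite !inE eqf_sqr.
rewrite cards2; suff -> : w != - w by [].
by rewrite -addr_eq0 -mulr2n -mulr_natl mulf_neq0.
Qed.

Lemma nsqrt_gt0 t : (0 < nsqrt t)%N -> exists w, t = w ^+ 2.
Proof. by case/card_gt0P=> w; rewrite inE => /eqP <-; exists w. Qed.

Lemma nsqrt_mul_sqr w t : w != 0 -> nsqrt (w ^+ 2 * t) = nsqrt t.
Proof.
move=> w0; rewrite /nsqrt -(card_imset [set v | v ^+ 2 == t] (mulfI w0)).
apply: eq_card => v; rewrite inE; apply/eqP/imsetP => [e|[v' + ->]].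
  exists (v / w); last by rewrite mulrC divfK.
  by rewrite inE expr_div_n e mulrC mulKf // expf_neq0.
by rewrite inE exprMn => /eqP->.
Qed.

Lemma sum_fiber_nat (T U : finType) (g : T -> U) (f : U -> nat) :
  (\sum_(x : T) f (g x) = \sum_(y : U) #|[set x | g x == y]| * f y)%N.
Proof.
rewrite (partition_big g predT) //=; apply: eq_bigr => y _.
rewrite (eq_bigr (fun=> f y)) => [|x /eqP-> //].
by rewrite sum_nat_const; congr (_ * _)%N; apply: eq_card => x; rewrite inE.
Qed.

Lemma sum_nsqrt : (\sum_(t : F) nsqrt t = #|F|)%N.
Proof.
rewrite -sum1_card (sum_fiber_nat (fun w : F => w ^+ 2) (fun=> 1%N)).
by apply: eq_bigr => t _; rewrite muln1.
Qed.

Lemma nsqrt_le2 t : (nsqrt t <= 2)%N.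
Proof.
have [->|t0] := eqVneq t 0; first by rewrite nsqrt0.
have [/nsqrt_gt0[w e]|] := ltnP 0 (nsqrt t); last by move/leq_trans; apply.
by rewrite e nsqrt_sqr //; apply: contraNneq t0 => w0; rewrite e w0 expr0n.
Qed.

(** The numbers [f t] are at most 2 and average 2, so all equal 2; take t = y. *)
Lemma nsqrt_mul_nonsqr x y : nsqrt x = 0%N -> nsqrt y = 0%N -> nsqrt (x * y) = 2%N.
Proof.
move=> rx ry; have x0 : x != 0 by apply: contra_eq_neq rx => ->; rewrite nsqrt0.
have y0 : y != 0 by apply: contra_eq_neq ry => ->; rewrite nsqrt0.
pose f t := (nsqrt t + nsqrt (x * t)%R)%N.
have f_le2 t : (f t <= 2)%N.
  rewrite /f; have [->|t0] := eqVneq t 0; first by rewrite mulr0 nsqrt0.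
  have [/nsqrt_gt0[w e]|] := ltnP 0 (nsqrt t); last by rewrite leqn0 => /eqP->; apply: nsqrt_le2.
  have w0 : w != 0 by apply: contraNneq t0 => w0; rewrite e w0 expr0n.
  by rewrite e mulrC nsqrt_mul_sqr // nsqrt_sqr // rx.
have sumf : (\sum_(t : F) f t = \sum_(t : F) 2)%N.
  rewrite big_split /= -(reindex_inj (mulfI x0) (F := nsqrt) (P := xpredT)) /=.
  by rewrite sum_nsqrt sum_nat_const addnn muln2.
have : (f y = 2)%N; last by rewrite /f ry.
apply/eqP; rewrite eqn_leq f_le2 /=.
have {}sumf : (f y + \sum_(t | t != y) f t = 2 + \sum_(t : F | t != y) 2)%N.
  by move: sumf; rewrite (bigD1 y) // [RHS](bigD1 y).
by rewrite -(leq_add2r (\sum_(t | t != y) f t)) sumf leq_add2l leq_sum.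
Qed.

(** This is chi(x) chi(y) = chi(x y), written without subtraction. *)
Lemma nsqrtM x y : (nsqrt x * nsqrt y + 2 = nsqrt x + nsqrt y + nsqrt (x * y)%R)%N.
Proof.
have [->|x0] := eqVneq x 0; first by rewrite mul0r nsqrt0; lia.
have [->|y0] := eqVneq y 0; first by rewrite mulr0 nsqrt0; lia.
have [/nsqrt_gt0[w e]|] := ltnP 0 (nsqrt x).
  have w0 : w != 0 by apply: contraNneq x0 => w0; rewrite e w0 expr0n.
  by rewrite e nsqrt_mul_sqr // nsqrt_sqr //; lia.
have [/nsqrt_gt0[w e] _|] := ltnP 0 (nsqrt y).
  have w0 : w != 0 by apply: contraNneq y0 => w0; rewrite e w0 expr0n.
  by rewrite e mulrC nsqrt_mul_sqr // nsqrt_sqr //; lia.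
rewrite !leqn0 => /eqP ry /eqP rx.
by rewrite (nsqrt_mul_nonsqr rx ry) rx ry.
Qed.
End Sqrt.

Lemma half_root_sq (K : numFieldType) (k : K) : k ^+ 2 = - 3 ->
  ((-1 + k) / 2) ^+ 2 = - 1 - (-1 + k) / 2.
Proof. by move=> e; field: e. Qed.

(** * Trace and the equation z^3 - z = s *)

Section Trace.
Variables (F : finFieldType) (h3 : 3 = 0 :> F) (m : nat) (hF : #|F| = (3 ^ m)%N).
Implicit Types x y z s t : F.

Lemma frob_pow i x y : (x + y) ^+ (3 ^ i)%N = x ^+ (3 ^ i)%N + y ^+ (3 ^ i)%N.
Proof. by elim: i => // i IH; rewrite expnSr !exprM IH cubeD. Qed.

Lemma TrD x y : Tr m (x + y) = Tr m x + Tr m y.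
Proof. by rewrite /Tr -big_split; apply: eq_bigr => i _; apply: frob_pow. Qed.

Lemma Tr0 : Tr m (0 : F) = 0.
Proof. by apply: (addrI (Tr m 0)); rewrite -TrD !addr0. Qed.

Lemma TrN x : Tr m (- x) = - Tr m x.
Proof. by apply: (addrI (Tr m x)); rewrite -TrD !subrr Tr0. Qed.

Lemma Tr_cube x : Tr m (x ^+ 3) = Tr m x.
Proof.
have -> : Tr m (x ^+ 3) = \sum_(i < m) x ^+ (3 ^ i.+1)%N.
  by apply: eq_bigr => i _; rewrite -exprM expnS.
(* After adding x, both sides are the sum over i <= m with an end term split off; the last term is
   x^q = x. *)
apply: (addrI (x ^+ (3 ^ 0)%N)).
rewrite -(big_ord_recl m (fun i : 'I_m.+1 => x ^+ (3 ^ i)%N)) big_ord_recr /= -hF.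
by rewrite expf_card addrC.
Qed.

Lemma cube_Tr x : Tr m x ^+ 3 = Tr m x.
Proof.
rewrite -[RHS]Tr_cube /Tr (big_morph (fun y : F => y ^+ 3) (cubeD h3) (expr0n _ 3)).
by apply: eq_bigr => i _; rewrite exprAC.
Qed.

Lemma Tr_as z : Tr m (z ^+ 3 - z) = 0.
Proof. by rewrite TrD TrN Tr_cube subrr. Qed.

Lemma Tr_val x : [|| Tr m x == 0, Tr m x == 1 | Tr m x == -1].
Proof.
have : Tr m x * (Tr m x ^+ 2 - 1) == 0.
  by rewrite mulrBr mulr1 -exprS cube_Tr subrr.
by rewrite mulf_eq0 subr_eq0 sqrf_eq1.
Qed.

Definition ntr (g : F -> F) (e : F) := #|[set x | Tr m (g x) == e]|.

Lemma sum_Tr (R : nmodType) (g : F -> F) (f : F -> R) :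
  \sum_x f (Tr m (g x)) = f 0 *+ ntr g 0 + f 1 *+ ntr g 1 + f (-1) *+ ntr g (-1).
Proof.
have split_by (e : F) (P : pred F) :
    \sum_(x | P x) f (Tr m (g x)) = f e *+ #|[set x | P x & Tr m (g x) == e]|
      + \sum_(x | P x && (Tr m (g x) != e)) f (Tr m (g x)).
  rewrite (bigID (fun x => Tr m (g x) == e)) /=; congr (_ + _).
  rewrite (eq_bigr (fun=> f e)) => [|x /andP[_ /eqP-> //]].
  by rewrite sumr_const; congr (_ *+ _); apply: eq_card => x; rewrite !inE.
have n10 : (1 : F) != 0 := oner_neq0 F.
have nN10 : (-1 : F) != 0 by rewrite oppr_eq0.
have nN1 : (-1 : F) != 1 by rewrite eq_sym one_neqN1.
rewrite (split_by 0) (split_by 1) (split_by (-1)) big1 => [|x]; last first.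
  by case/or3P: (Tr_val (g x)) => ->; rewrite ?andbF.
rewrite addr0 addrA; congr (_ *+ _ + _ *+ _ + _ *+ _); apply: eq_card => x;
  rewrite !inE //=.
  by case: (Tr m (g x) =P 1) => [->|]; rewrite ?n10 ?andbF.
by case: (Tr m (g x) =P -1) => [->|]; rewrite ?nN10 ?nN1 ?andbF.
Qed.

Lemma ntr_sum g : (ntr g 0%R + ntr g 1%R + ntr g (-1)%R = #|F|)%N.
Proof.
have nE n : 1%N *+ n = n := natn n.
by have := sum_Tr g (fun=> 1%N); rewrite !nE -sum1_card => ->.
Qed.

Lemma ntr_opp g e : (forall x, g (- x) = - g x) -> ntr g (- e) = ntr g e.
Proof.
move=> gN; rewrite /ntr -(card_imset [set x | Tr m (g x) == e] (@oppr_inj F)).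
apply: eq_card => x; rewrite inE; apply/eqP/imsetP => [h|[y + ->]].
  by exists (- x); rewrite ?opprK // inE gN TrN h opprK.
by rewrite inE gN TrN => /eqP->.
Qed.

Definition Kl_arg (a x : F) := x + a / x.

Lemma omega_sq : omega ^+ 2 = - 1 - omega.
Proof.
have e : ('i * sqrtC 3) ^+ 2 = - 3 :> algC.
  by rewrite exprMn sqrCi sqrtCK mulN1r.
by rewrite /omega half_root_sq.
Qed.

(** x + a / x is odd, so the traces 1 and -1 are equally frequent, and omega + omega^2 = -1. *)
Lemma Kl_eq a : Kl m a = (ntr (Kl_arg a) 0)%:R - (ntr (Kl_arg a) 1)%:R.
Proof.
rewrite /Kl (sum_Tr (Kl_arg a) (fun t => omega ^+ f3exp t)).
have -> : ntr (Kl_arg a) (-1) = ntr (Kl_arg a) 1.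
  by apply: ntr_opp => x; rewrite /Kl_arg invrN mulrN opprD.
rewrite /f3exp eqxx oner_eq0 eqxx oppr_eq0 oner_eq0 eq_sym (negPf (one_neqN1 h3)).
move: omega_sq (ntr _ 0) (ntr _ 1); move: omega => w -> n0 n1.
by rewrite expr0 expr1 -addrA -mulrnDl [w + _]addrC subrK mulNrn.
Qed.

Section NontrivialTrace.
Hypothesis Tr_neq0 : exists y, Tr m y != 0.

(** Translation by an element of trace 1 matches trace 0 with trace 1; negation matches 1 with
    -1. *)
Lemma ntr_id : (3 * ntr id 0%R = #|F|)%N.
Proof.
have [y1 ty] : exists y, Tr m y = 1.
  have [y ny] := Tr_neq0; have := Tr_val y; rewrite (negPf ny) /= => /orP[]/eqP e.
    by exists y.
  by exists (- y); rewrite TrN e opprK.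
rewrite -(ntr_sum id) (ntr_opp 1) //.
suff -> : ntr id 1 = ntr id 0 by lia.
rewrite /ntr -(card_imset [set x | Tr m (id x) == 0] (addrI y1)).
apply: eq_card => x; rewrite inE; apply/eqP/imsetP => [h|[y + ->]].
  by exists (x - y1); rewrite ?inE ?TrD ?TrN ?h ?ty ?subrr // addrC subrK.
by rewrite inE TrD => /eqP ->; rewrite addr0.
Qed.

Definition nas s := #|[set z : F | z ^+ 3 - z == s]|.

Lemma nas_im z : nas (z ^+ 3 - z) = 3%N.
Proof.
transitivity #|[set z; z - 1; z - -1]|.
  apply: eq_card => v; rewrite !inE; apply/eqP/idP => [e|].
    have [d -> hd] := artin_schreier_fiber h3 e.
    by case: hd => [->|/sqr_eq1[]->]; rewrite ?subr0 eqxx ?orbT.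
  case/orP=> [/orP[]|] /eqP -> //; apply: (slope_shift h3); right.
    by rewrite expr1n.
  by rewrite sqrrN expr1n.
rewrite -setUA cardsU1 cards2 !inE negb_or !(inj_eq (addrI z)) opprK.
rewrite -[X in (X == z - 1)]addr0 -[X in (X == z + 1)]addr0 !(inj_eq (addrI z)).
rewrite eq_sym oppr_eq0 oner_eq0 eq_sym oner_eq0 eq_sym.
by rewrite (negPf (one_neqN1 h3)).
Qed.

(** Additive Hilbert 90 by counting: the image of z^3 - z lies in the kernel of the trace, and both
    have |F| / 3 elements. *)
Lemma nasE s : nas s = if Tr m s == 0 then 3%N else 0%N.
Proof.
pose K0 := [set x : F | Tr m x == 0].
pose I := [set z ^+ 3 - z | z in F].
have IK : I \subset K0 by apply/subsetP => _ /imsetP[z _ ->]; rewrite inE Tr_as.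
have cI : (#|F| = 3 * #|I|)%N.
  rewrite -[LHS]sum1_card (partition_big_imset (fun z : F => z ^+ 3 - z)) /=.
  rewrite (eq_bigr (fun=> 3%N)); first by rewrite sum_nat_const mulnC.
  move=> _ /imsetP[z _ ->]; rewrite sum1dep_card -[RHS](nas_im z).
  by apply: eq_card => x; rewrite !inE.
have /eqP IE : I == K0.
  rewrite eqEcard IK /= -(leq_pmul2l (isT : 0 < 3)%N) -cI.
  by rewrite -ntr_id.
have <- : (s \in I) = (Tr m s == 0) by rewrite IE inE.
case: imsetP => [[z _ ->]|nI]; first exact: nas_im.
apply/eqP; rewrite cards_eq0; apply/eqP/setP => z; rewrite !inE.
by apply/eqP => e; case: nI; exists z.
Qed.

End NontrivialTrace.
End Trace.

(** * The identity |E(a)| = q + K(a) *)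

Section PointCount.
Variables (F : finFieldType) (h3 : 3 = 0 :> F) (m : nat) (hF : #|F| = (3 ^ m)%N).
Variables (a : F) (a0 : a != 0).
Hypothesis Tr_neq0 : exists y : F, Tr m y != 0.

Let two0 : (2 : F) != 0 := two_neq0 h3.

Definition naff := (\sum_(x : F) nsqrt (x ^+ 3 + x ^+ 2 - a)%R)%N.
Definition nquad := (\sum_(z : F) nsqrt ((z ^+ 3 - z) ^+ 2 - a)%R)%N.

Lemma card_pts : #|pts a| = naff.+1.
Proof.
have -> : pts a = None |: Some @: [set p : F * F | p.2 ^+ 2 == p.1 ^+ 3 + p.1 ^+ 2 - a].
  apply/setP => -[p|]; last by rewrite !inE.
  by rewrite 3!inE /= mem_imset ?inE // => ? ? [].
rewrite cardsU1; have -> : None \in Some @: [set p : F * F | p.2 ^+ 2 == p.1 ^+ 3 + p.1 ^+ 2 - a] = false.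
  by apply/imsetP => -[].
rewrite add1n card_imset => [|? ? []//]; congr _.+1.
rewrite -sum1dep_card /naff.
rewrite (eq_bigr (fun x : F => \sum_(y : F | (y ^+ 2 == x ^+ 3 + x ^+ 2 - a)%R) 1)%N) => [|x _].
  by rewrite pair_big_dep.
by rewrite sum1dep_card.
Qed.

(** Substitute x = -(s + w): as (s + w)(s - w) = a, x + a / x = -2 s = s. *)
Lemma nsqrt_kl s : nsqrt (s ^+ 2 - a) = #|[set x | (x != 0) && (x + a / x == s)]|.
Proof.
have inj : injective (fun w => - (s + w)) by move=> w w' /oppr_inj/addrI.
rewrite /nsqrt -(card_imset _ inj); apply: eq_card => x; rewrite inE.
apply/imsetP/andP => [[w + ->]|[x0 /eqP e]].
  rewrite inE => /eqP e.
  have ea : (s + w) * (s - w) = a.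
    by transitivity (s ^+ 2 - w ^+ 2); [ring|rewrite e; ring].
  have sw : s + w != 0 by apply: contra_neq a0 => h; rewrite -ea h mul0r.
  rewrite oppr_eq0 sw; split=> //; apply/eqP.
  by rewrite -{1}ea invrN mulrN [(s + w) * _]mulrC mulfK //; ring3 h3.
exists (- x - s); last by ring.
rewrite inE -e; apply/eqP.
by field3 h3.
Qed.

(** First count of w^2 = (z^3 - z)^2 - a: each nonzero x with Tr(x + a / x) = 0 gives three z. The 3
    on the left is the term x = 0, where a / 0 = 0. *)
Lemma nquad_ntr : (nquad + 3 = 3 * ntr m (Kl_arg a) 0%R)%N.
Proof.
have -> : (3 * ntr m (Kl_arg a) 0%R = \sum_x nas (Kl_arg a x))%N.
  rewrite (eq_bigr (fun x : F => if Tr m (Kl_arg a x) == 0%R then 3 else 0)%N) => [|x _].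
    rewrite -big_mkcond sum_nat_const mulnC; congr (_ * _)%N.
    by apply: eq_card => x; rewrite inE.
  exact: nasE.
rewrite (bigD1 0) //=; have -> : nas (Kl_arg a 0) = 3%N.
  by rewrite (nasE h3 hF Tr_neq0) /Kl_arg invr0 mulr0 addr0 Tr0 ?eqxx.
rewrite addnC; congr (_ + _)%N; rewrite /nquad.
rewrite [LHS](eq_bigr (fun z : F => \sum_(x : F | (x != 0%R) && (x + a / x == z ^+ 3 - z)%R) 1)%N) => [|z _].
  rewrite (exchange_big_dep (fun x : F => x != 0)) /= => [|z x _ /andP[] //].
  apply: eq_bigr => x x0; rewrite sum1dep_card; apply: eq_card => z.
  by rewrite !inE x0 eq_sym.
by rewrite sum1dep_card nsqrt_kl.
Qed.

(** (z^3 - z)^2 - a as a polynomial in t = z^2, using -2 = 1. *)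
Let f (t : F) := t ^+ 3 + t ^+ 2 + t - a.

Lemma sum_nsqrt_f : (\sum_(t : F) nsqrt (f t) = naff)%N.
Proof.
rewrite (reindex_inj (addrI (1 : F))) /=; apply: eq_bigr => x _.
by congr (@nsqrt F _); rewrite /f; ring3 h3.
Qed.

Lemma nsqrt_cube (t : F) : nsqrt (t ^+ 3) = nsqrt t.
Proof.
have [->|t0] := eqVneq t 0; first by rewrite expr0n.
by rewrite exprSr nsqrt_mul_sqr.
Qed.

(** t f(t) = t^4 h(1 / t), and h(0) = 1 has two square roots against one for t = 0, whence the 1.
    Frobenius replaces a by a^3 in [naff], and X = a (1 - x) turns X^3 + X^2 - a^3 into a^2 h(x). *)
Lemma sum_nsqrt_tf : (\sum_(t : F) nsqrt (t * f t)%R + 1 = naff)%N.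
Proof.
pose h (x : F) := 1 + x + x ^+ 2 - a * x ^+ 3.
transitivity (\sum_x nsqrt (h x))%N.
  rewrite (bigD1 0) //= mul0r nsqrt0 [RHS](bigD1 0) //=.
  have -> : nsqrt (h 0) = 2%N.
    have -> : h 0 = 1 ^+ 2 by rewrite /h; ring.
    by rewrite nsqrt_sqr // oner_neq0.
  rewrite [X in _ = (_ + X)%N](reindex_inj (@invr_inj F)) /=.
  rewrite (eq_bigl (fun t : F => t^-1 != 0)) => [|t]; last by rewrite invr_eq0.
  rewrite addnC addnA; congr (_ + _)%N; apply: eq_bigr => t; rewrite invr_eq0 => t0.
  rewrite -(nsqrt_mul_sqr (h t^-1) (expf_neq0 2 t0)); congr (@nsqrt F _).
  by rewrite /f /h; field.
rewrite [RHS](eq_bigr (fun x => nsqrt ((x ^+ 3) ^+ 3 + (x ^+ 3) ^+ 2 - a ^+ 3))) => [|x _].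
  rewrite -(reindex_inj (cube_inj h3) (P := xpredT) (F := fun x => nsqrt (x ^+ 3 + x ^+ 2 - a ^+ 3))).
  have inj : injective (fun x : F => a * (1 - x)).
    by move=> x y /(mulfI a0)/addrI/oppr_inj.
  rewrite [RHS](reindex_inj inj) /=; apply: eq_bigr => x _.
  by rewrite -(nsqrt_mul_sqr (h x) a0); congr (@nsqrt F _); rewrite /h; ring3 h3.
by rewrite -nsqrt_cube; congr (@nsqrt F _); ring3 h3.
Qed.

(** Second count: sum over t = z^2 and apply multiplicativity of chi to t and f(t). *)
Lemma nquad_naff : (nquad + #|F| + 1 = 2 * naff)%N.
Proof.
have -> : nquad = (\sum_(t : F) nsqrt t * nsqrt (f t))%N.
  rewrite -(sum_fiber_nat (fun z : F => z ^+ 2) (fun t => nsqrt (f t))).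
  by apply: eq_bigr => z _; congr (@nsqrt F _); rewrite /f; ring3 h3.
have : (\sum_(t : F) (nsqrt t * nsqrt (f t) + 2) =
        \sum_(t : F) (nsqrt t + nsqrt (f t) + nsqrt (t * f t)%R))%N.
  by apply: eq_bigr => t _; apply: nsqrtM.
rewrite !big_split /= sum_nat_const sum_nsqrt sum_nsqrt_f.
have := sum_nsqrt_tf; set S := (\sum_(t : F) nsqrt (t * f t)%R)%N.
set A := (\sum_(t : F) _)%N; have -> : #|[pred _ : F | true]| = #|F| by [].
by lia.
Qed.

Lemma card_pts_ntr :
  (#|pts a| + ntr m (Kl_arg a) 1%R = #|F| + ntr m (Kl_arg a) 0%R)%N.
Proof.
have := ntr_sum h3 hF (Kl_arg a).
have -> : ntr m (Kl_arg a) (-1) = ntr m (Kl_arg a) 1.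
  by apply: ntr_opp => // x; rewrite /Kl_arg invrN mulrN opprD.
have := nquad_ntr; have := nquad_naff; rewrite card_pts; lia.
Qed.

Lemma card_pts_Kl : #|pts a|%:R = #|F|%:R + Kl m a :> algC.
Proof.
rewrite (Kl_eq h3 hF) addrA -natrD -card_pts_ntr natrD.
by rewrite addrK.
Qed.
End PointCount.

(** * The exact power of 3 in K(a) *)

Section Kloosterman.
Variables (F : finFieldType) (m : nat) (hF : #|F| = (3 ^ m)%N).
Implicit Types (a c u : F) (p q : F * F) (P Q : option (F * F)).

Lemma three_eq0 : 3 = 0 :> F.
Proof. by have /pcharf0 := card_finPcharP hF (isT : prime 3). Qed.

Let h3 := three_eq0.

Lemma cbrtK a : (0 < m)%N -> cbrt a ^+ 3 = a.
Proof.
move=> m0; rewrite /cbrt; case: pickP => [x /eqP //|/(_ (a ^+ (3 ^ m.-1)%N))].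
by rewrite -exprM -expnSr prednK // -hF expf_card eqxx.
Qed.

Lemma Tr_htr a u y : u != 0 -> y ^+ 2 = u ^+ 3 + u ^+ 2 - a ->
  Tr m (a * y / u ^+ 3) = Tr m y.
Proof.
move=> u0 E; rewrite -[RHS]subr0 -(Tr_as h3 hF (y / u)) -(TrN h3) -(TrD h3).
congr Tr; have -> : a = u ^+ 3 + u ^+ 2 - y ^+ 2 by rewrite E; ring.
by field.
Qed.

Lemma Tr_trip c p : Tr m p.2 != 0 -> Some p \notin trip c @: pts (c ^+ 3).
Proof.
move=> t; apply/imsetP => -[[q|] //= _]; case: ifP => // _ [ep].
by move: t; rewrite ep /= (Tr_cube hF) (Tr_as h3 hF) eqxx.
Qed.

(** Two ordinates per abscissa suffice: 2 q + 1 < 3 q for q > 1, which bounds k by m. *)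
Lemma card_pts_bounds a :
  (0 < #|pts a|)%N /\ (#|pts a| <= 2 * 3 ^ m + 1)%N.
Proof.
rewrite card_pts; split=> //; rewrite addn1 ltnS -hF /naff.
rewrite -[X in (_ <= X)%N]/(2 * #|F|)%N mulnC -sum_nat_const.
by apply: leq_sum => x _; apply: nsqrt_le2 (two_neq0 h3) _.
Qed.

(** K(a) = |E(a)| - q = 3^k D with D = N - 3^(m-k); K(a) = 0 occurs only for k = m, as the
    convention demands. *)
Lemma pow3_dvd_Kl a k N : (1 < m)%N -> a != 0 -> (exists y : F, Tr m y != 0) ->
    #|pts a| = (3 ^ k * N)%N -> ~~ (3 %| N)%N ->
  [/\ (k <= m)%N, pow3_dvd m k (Kl m a) & ~~ pow3_dvd m k.+1 (Kl m a)].
Proof.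
move=> m1 a0 htr cP nN; have [c0 cle] := card_pts_bounds a.
have N0 : (0 < N)%N by move: c0; rewrite cP muln_gt0 => /andP[].
have q1 : (1 < 3 ^ m)%N by rewrite -{1}(expn0 3) ltn_exp2l // ltnW.
have km : (k <= m)%N.
  rewrite -ltnS -(ltn_exp2l (m := 3)) // expnS.
  by rewrite (leq_ltn_trans (leq_pmulr (3 ^ k) N0)) // -cP; lia.
have qE : (3 ^ m = 3 ^ k * 3 ^ (m - k))%N by rewrite -expnD subnKC.
pose D : int := N%:Z - (3 ^ (m - k))%N%:Z.
have KE : Kl m a = 3 ^+ k * D%:~R.
  have := card_pts_Kl h3 hF a0 htr; rewrite hF cP qE => e.
  rewrite -[LHS](addKr (3 ^ k * 3 ^ (m - k))%N%:R) -e /D.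
  by rewrite rmorphB /= mulrBr addrC !natrM natrX.
(* For k < m, 3 divides 3^(m-k) but not N. For k = m, D = N - 1 with 1 <= N <= 2. *)
have D3 z : D = 3 * z -> D = 0 /\ k = m.
  rewrite /D; have [mk|km'] := posnP (m - k).
    have {}km : k = m by lia.
    have : (N <= 2)%N by move: cle; rewrite cP km; nia.
    by rewrite mk expn0; split=> //; lia.
  move=> e; case/negP: nN; rewrite -(prednK km') expnS in e.
  by lia.
have k0 : (3 : algC) ^+ k != 0 by rewrite expf_neq0 // pnatr_eq0.
rewrite /pow3_dvd KE mulf_eq0 (negPf k0) /= intr_eq0.
have [DE|DE] := eqVneq D 0.
  have [_ e] : D = 0 /\ k = m by apply: (D3 0); rewrite DE mulr0.
  by rewrite e leqnn ltnn.
split=> //; first by rewrite [_ * D%:~R]mulrC mulfK // Aint_int.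
apply/negP => h; have three0 : (3 : algC) != 0 by rewrite pnatr_eq0.
have e : 3 ^+ k * D%:~R / 3 ^+ k.+1 = D%:~R / 3 :> algC.
  by rewrite exprSr -mulf_div divff ?mul1r.
have rat : D%:~R / 3 \in Crat by rewrite rpred_div // ?rpred_int // rpred_nat.
rewrite e in h; have /intrP[z ez] := Cint_rat_Aint rat h.
have /D3[D0 _] : D = 3 * z; last by rewrite D0 eqxx in DE.
apply: (intr_inj (R := algC)); rewrite rmorphM /= -ez mulrC divfK //.
Qed.

End Kloosterman.

(** * From the orbit on the curve to the sequence u_i *)

Section Orbit.
Variables (F : finFieldType) (h3 : 3 = 0 :> F) (c : F) (c0 : c != 0).
Local Notation a := (c ^+ 3).

Lemma trip_dichotomy P : P \in pts a -> P \notin trip c @: pts a ->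
  exists k N, [/\ #|pts a| = (3 ^ k * N)%N, ~~ (3 %| N)%N &
    (exists i, [/\ k = i.+1, iter i (trip c) P = W c \/ iter i (trip c) P = neg (W c)
       & forall j, (j < k)%N -> iter j (trip c) P != None]) \/
    (forall j, iter j (trip c) P != None) /\
    exists2 r, (0 < r)%N &
      (iter (r + k) (trip c) P = iter k (trip c) P \/
       iter (r + k) (trip c) P = neg (iter k (trip c) P)) /\
      (forall i j, (i < j)%N -> (j < r + k)%N ->
        iter j (trip c) P != iter i (trip c) P /\
        iter j (trip c) P != neg (iter i (trip c) P))].
Proof.
apply: (@tripling_dichotomy _ (col a)) => //; rewrite ?inE //.
- exact: col_sym.
- exact: col_rot.
- exact: (col_ex h3).
- by move=> p q r r'; apply: (col_uniq h3); apply: a_neq0.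
- exact: col_neg.
- exact: (col_flex h3).
- by have := W_pts c; rewrite inE.
- exact: (trip_pts h3).
- by move=> p q r H _ _ _; apply: (trip_col h3 c0).
- exact: (trip_ker c0).
- exact: (trip_eq h3 c0).
- exact: (trip_fiber h3 c0).
Qed.

(** Until the orbit reaches infinity its first coordinates are the u's, with a shift of one because
    [useq] is indexed from 1. *)
Lemma iter_trip_x u y i : Some (u, y) \in pts a ->
    (forall j, (j <= i)%N -> iter j (trip c) (Some (u, y)) != None) ->
  exists v, iter i (trip c) (Some (u, y)) = Some (useq a u i.+1, v) /\
    onE a (Some (useq a u i.+1, v)).
Proof.
move=> SP; elim: i => [|i IH] nO; first by exists y; move: SP; rewrite inE.
have [j ji|v [e E]] := IH; first by apply: nO; apply: leqW.
have := nO i.+1 (leqnn _); rewrite iterS e /=; case: ifP => // /negbT xc _.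
have := trip_pts h3 (c := c) (P := Some (useq a u i.+1, v)).
rewrite !inE => /(_ E); rewrite /trip /= (negPf xc) => E'.
have -> : useq a u i.+2 = ver_x c (useq a u i.+1, v) ^+ 3.
  by rewrite (trip_ustep (p := (_, v)) h3 xc E).
by exists (ver_y c (useq a u i.+1, v) ^+ 3).
Qed.

Lemma iter_trip_neq u y i : Some (u, y) \in pts a ->
    (forall j, (j <= i.+1)%N -> iter j (trip c) (Some (u, y)) != None) ->
  useq a u i.+1 != c.
Proof.
move=> SP nO; have [j ji|v [e _]] := iter_trip_x SP (i := i).
  by apply: nO; apply: leqW.
by have := nO i.+1 (leqnn _); rewrite iterS e /=; case: ifP => // /negbT.
Qed.

Lemma onE_same_x p q : onE a (Some p) -> onE a (Some q) -> p.1 = q.1 ->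
  Some q = Some p \/ Some q = neg (Some p).
Proof.
case: p q => [x y] [x' y'] /= /eqP E /eqP E' e; subst x'.
have /eqP : y' ^+ 2 = y ^+ 2 by rewrite E E'.
by rewrite eqf_sqr => /orP[]/eqP->; [left|right].
Qed.

End Orbit.

Theorem theorem1 (m : nat) (F : finFieldType) (hF : #|F| = (3 ^ m)%N)
  (hm : (2 <= m)%N) (a : F) (ha : a != 0) (u1 y : F)
  (hE : (u1, y) \in Ecurve a)
  (htr : Tr m (a * y / u1 ^+ 3) != 0) :
  exists k : nat, (k <= m)%N /\
    ( ( (1 <= k)%N /\ useq a u1 k = cbrt a /\
        (forall i : nat, (1 <= i < k)%N -> useq a u1 i != cbrt a) )
      \/
      (exists r : nat, (1 <= r)%N /\
         useq a u1 (k + 1) = useq a u1 (k + 1 + r) /\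
         (forall i : nat, (1 <= i < k + 1 + r)%N -> useq a u1 i != cbrt a) /\
         (forall i j : nat, (1 <= i < k + 1 + r)%N -> (1 <= j < k + 1 + r)%N ->
            useq a u1 i = useq a u1 j -> i = j)) )
    /\ pow3_dvd m k (Kl m a) /\ ~~ pow3_dvd m k.+1 (Kl m a).
Proof.
have h3 := three_eq0 hF; have m0 := ltnW hm.
set c := cbrt a; have ca : c ^+ 3 = a := cbrtK hF a m0.
have c0 : c != 0 by apply: contra_neq ha => e; rewrite -ca e expr0n.
have Ey : y ^+ 2 = u1 ^+ 3 + u1 ^+ 2 - a by move: hE; rewrite inE => /eqP.
(* Division by zero gives 0, so u1 = 0 would make the trace in [htr] vanish. *)
have u10 : u1 != 0.
  by apply: contraNneq htr => ->; rewrite expr0n invr0 mulr0 (Tr0 h3).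
have ty : Tr m y != 0 by rewrite -(Tr_htr hF u10 Ey).
have SP : Some (u1, y) \in pts (c ^+ 3) by rewrite inE ca; apply/eqP.
have nP := Tr_trip hF c (p := (u1, y)) ty.
have [k [N [cP nN cases]]] := trip_dichotomy h3 c0 SP nP.
have exy : exists y0 : F, Tr m y0 != 0 by exists y.
rewrite ca in cP; have [km dv ndv] := pow3_dvd_Kl hF hm ha exy cP nN.
exists k; split=> //; split=> //; rewrite -ca.
case: cases => [[i [ki e nO]]|[nO [r r0 [e ne]]]].
  (* The iterate of index k - 1 is [W] or [neg W], so u_k = c. *)
  left; rewrite ki; split=> //; split.
    have [j ji|v [ev _]] := iter_trip_x h3 SP (i := i); first by apply: nO; rewrite ki.
    by move: e; rewrite ev => -[] [].
  case=> // j /andP[_ ji]; apply: (iter_trip_neq h3 SP) => j' jj'; apply: nO.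
  by rewrite ki; lia.
have X i := iter_trip_x h3 SP (i := i) (fun j _ => nO j).
right; exists r; split=> //; split; last split.
- rewrite !addn1 addSn addnC.
  have [v [ev _]] := X k; have [v' [ev' _]] := X (r + k)%N.
  by move: e; rewrite ev ev' => -[] [].
- by case=> // i _; apply: (iter_trip_neq h3 SP) => j _; apply: nO.
- have lt_neq i j : (i < j)%N -> (j < r + k)%N ->
      useq (c ^+ 3) u1 i.+1 != useq (c ^+ 3) u1 j.+1.
    move=> ij jr; apply/eqP => eij; have [v [ev Ev]] := X i; have [v' [ev' Ev']] := X j.
    have [] := ne i j ij jr; rewrite ev ev'.
    (* Equal first coordinates mean equal up to sign, which minimality of the period excludes. *)
    by case: (onE_same_x Ev Ev' eij) => ->; rewrite eqxx.
  case=> // i [|j] // ib jb eij.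
  case: (ltngtP i j) => [ij|ji|->//].
    by have := lt_neq i j ij; rewrite eij eqxx => /(_ ltac:(lia)).
  by have := lt_neq j i ji; rewrite eij eqxx => /(_ ltac:(lia)).
Qed.
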